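(* Let $k\ge1$, let $\alpha_1,\beta_1,\beta_2\in\mathbb{R}$ (possibly depending on $h$) with $\alpha_1^2+\beta_1\beta_2\ne\frac14$, assume a uniform mesh of size $h$, and suppose $|\Gamma|<|\Lambda|$ (Case 3) and that $P_h^\star$ is well defined, i.e. $\lambda_1^N\ne1$. Assume $|1-\lambda_1^N|\sim O(h^{\delta'})$. Then for $p=2,\infty$ and periodic $u\in W^{k+1,\infty}(I)$, $$\|P_h^\star u-u\|_{L^p(I)}\le Ch^{k+1}|u|_{W^{k+1,\infty}(I)}\Big(1+h^{-(\delta'+1)}\|Q_1\|_\infty\big(\|V_1\|_\infty+h^{-1}\|V_2\|_\infty\big)\Big).$$
   Context: Mesh: $I=[a,b]$, $a=x_{1/2}<\dots<x_{N+1/2}=b$, $I_j=(x_{j-1/2},x_{j+1/2})$, uniform with $h=(b-a)/N$. $V_h^k$ is the space of functions on $I$ whose restriction to each $I_j$ is a polynomial of degree at most $k$. At an interface, $v^\pm$ denote the limits from the right ($+$) and left ($-$) cells, with periodic identification of $x_{1/2}$ and $x_{N+1/2}$; $[v]=v^+-v^-$, $\{v\}=\frac12(v^++v^-)$; the same notation is used for the piecewise derivative $v_x$. Projection $P_h^\star$ (depending on $\alpha_1,\beta_1,\beta_2$): for a periodic function $u$, $P_h^\star u$ is the unique $w\in V_h^k$ satisfying, for all $j=1,\dots,N$, (i) $\int_{I_j}w\,v_h\,dx=\int_{I_j}u\,v_h\,dx$ for all $v_h\in P^{k-2}(I_j)$ (void if $k=1$); (ii) $\{w\}-\alpha_1[w]+\beta_2[w_x]=u$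 at $x_{j+1/2}$; (iii) $\{w_x\}+\alpha_1[w_x]+\beta_1[w]=u_x$ at $x_{j+1/2}$. Quantities: $\Gamma=\beta_1+\frac{k^2(k^2-1)}{h^2}\beta_2-\frac{2k^2}{h}(\alpha_1^2+\beta_1\beta_2+\frac14)$, $\Lambda=-\frac{2k}{h}(\alpha_1^2+\beta_1\beta_2-\frac14)$, $c_2=\frac{2k\alpha_1}{h}$, $b_1=-\beta_1-\frac{k^2(k^2+1)}{h^2}\beta_2+\frac{2k^2}{h}(\alpha_1^2+\beta_1\beta_2+\frac14)$, $b_2=-\frac{2k^3}{h^2}\beta_2+\frac{2k}{h}(\alpha_1^2+\beta_1\beta_2+\frac14)$, $\lambda_1=\frac{(-1)^{k+1}}{\Lambda}(\Gamma+\sqrt{\Gamma^2-\Lambda^2})$, where $\sqrt{\Gamma^2-\Lambda^2}=i\sqrt{\Lambda^2-\Gamma^2}$ (so $|\lambda_1|=1$), $$Q_1=\frac{1}{2\sqrt{\Gamma^2-\Lambda^2}}\begin{bmatrix}c_2+\sqrt{\Gamma^2-\Lambda^2}&b_1+b_2\\ b_1-b_2&-c_2+\sqrt{\Gamma^2-\Lambda^2}\end{bmatrix},$$ $$V_1=\frac1\Lambda\begin{bmatrix}-\beta_1+\frac{k(k+1)}{h}\big((\frac12-\alpha_1)^2+\beta_1\beta_2\big)\\ \beta_1-\frac{k(k-1)}{h}\big((\frac12-\alpha_1)^2+\beta_1\beta_2\big)\end{bmatrix},\quad V_2=\begin{bmatrix}-\frac{h}{2k}\\ \frac{h}{2k}\end{bmatrix}.$$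 $\|\cdot\|_\infty$ is the max norm of vectors and the induced matrix norm. $X\sim O(h^{s})$ means that $X$ is of exact order $h^s$ during mesh refinement, i.e. bounded above and below by positive constants (independent of $h$) times $h^s$; the constant $C$ may depend on these constants. ''Periodic $u\in W^{m,\infty}(I)$'' means that the $(b-a)$-periodic extension of $u$ has this regularity; $|u|_{W^{m,\infty}(I)}$ is the Sobolev seminorm. Apart from the dependence just mentioned, $C$ is a generic constant independent of $h$, of $\alpha_1,\beta_1,\beta_2$, and of $u$. *)

(* Defs.v *)
From HB Require Import structures.
From mathcomp Require Import all_boot all_order all_algebra.
From mathcomp Require Import all_classical all_reals all_analysis.
From mathcomp Require Import complex.
Set Implicit Arguments.
Unset Strict Implicit.
Unset Printing Implicit Defensive.
Import Order.TTheory GRing.Theory Num.Theory.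
Import numFieldNormedType.Exports.
Local Open Scope classical_set_scope.
Local Open Scope ring_scope.
Local Open Scope complex_scope.

Definition is_Linfty (R : realType) (f : R -> R) : Prop :=
  f \in Lfun (@lebesgue_measure R) +oo%E.

Definition C1c (R : realType) (phi : R -> R) : Prop :=
  [/\ forall x, derivable phi x 1, continuous (derive1 phi)
    & exists M : R, forall x, M < `|x| -> phi x = 0].

(* As usual in one dimension (e.g. Brezis, Chapter 8), weak derivatives are
   tested against C^1 functions with compact support, and higher-order Sobolev
   spaces are defined by iterating the first-order notion. *)
Definition weak_deriv (R : realType) (u g : R -> R) : Prop :=
  forall phi, C1c phi ->
    \int[@lebesgue_measure R]_x (u x * derive1 phi x)
    = - \int[@lebesgue_measure R]_x (g x * phi x).

Fixpoint weak_derivn_Linfty (R : realType) (m : nat) (u g : R -> R) : Prop :=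
  match m with
  | 0%N => is_Linfty u /\ u = g
  | m'.+1 => is_Linfty u /\
      exists v, weak_deriv u v /\ weak_derivn_Linfty m' v g
  end.

Definition W_infty (R : realType) (m : nat) (u : R -> R) : Prop :=
  exists g, weak_derivn_Linfty m u g.

Definition Lp_norm (R : realType) (a b : R) (p : \bar R) (f : R -> R) :
    \bar R :=
  Lnorm (@lebesgue_measure R) p (EFin \o (f \_ `[a, b])).

(* The m-th weak derivative is unique up to a null set, so the seminorm does not
   depend on the representative picked by xget. *)
Definition W_infty_seminorm (R : realType) (a b : R) (m : nat) (u : R -> R) :
    \bar R :=
  Lp_norm a b +oo%E (xget (cst 0) [set g | weak_derivn_Linfty m u g]).

Definition mesh_size (R : realType) (a b : R) (N : nat) : R := (b - a) / N%:R.

(* node a b N j is x_{j+1/2}, for 0 <= j <= N. *)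
Definition node (R : realType) (a b : R) (N j : nat) : R :=
  a + j%:R * mesh_size a b N.

(* Cells are numbered from 0: cell a b N j is I_{j+1}, for j < N. *)
Definition cell (R : realType) (a b : R) (N j : nat) : set R :=
  `]node a b N j, node a b N j.+1[.

Definition Vh (R : realType) (a b : R) (N k : nat) (w : R -> R) : Prop :=
  forall j, (j < N)%N -> exists p : {poly R},
    (size p <= k.+1)%N /\ forall x, cell a b N j x -> w x = p.[x].

(* One-sided limits at the right end point x_{j+3/2} of cell j; for j = N - 1,
   the limit from the right is taken at x_{1/2} (periodicity). *)
Definition trace_minus (R : realType) (a b : R) (N : nat) (v : R -> R)
    (j : nat) : R :=
  lim (v x @[x --> (node a b N j.+1)^'-]).

Definition trace_plus (R : realType) (a b : R) (N : nat) (v : R -> R)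
    (j : nat) : R :=
  lim (v x @[x --> (node a b N (j.+1 %% N))^'+]).

Definition jump (R : realType) (a b : R) (N : nat) (v : R -> R) (j : nat) : R :=
  trace_plus a b N v j - trace_minus a b N v j.

Definition average (R : realType) (a b : R) (N : nat) (v : R -> R) (j : nat) :
    R :=
  (trace_plus a b N v j + trace_minus a b N v j) / 2.

(* w is a projection P_h^* u.  Polynomials of degree at most k - 2 are those of
   size at most k - 1, i.e. only 0 when k = 1. *)
Definition is_Pstar (R : realType) (a b : R) (N k : nat)
    (alpha1 beta1 beta2 : R) (u w : R -> R) : Prop :=
  Vh a b N k w /\
  forall j, (j < N)%N ->
  [/\ forall v : {poly R}, (size v <= k.-1)%N ->
        \int[@lebesgue_measure R]_(x in cell a b N j) (w x * v.[x])
        = \int[@lebesgue_measure R]_(x in cell a b N j) (u x * v.[x]),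
      average a b N w j - alpha1 * jump a b N w j
        + beta2 * jump a b N (derive1 w) j = u (node a b N j.+1)
    & average a b N (derive1 w) j + alpha1 * jump a b N (derive1 w) j
        + beta1 * jump a b N w j = derive1 u (node a b N j.+1)].

Section Quantities.
Variables (R : realType) (k : nat) (h alpha1 beta1 beta2 : R).

Definition Gamma : R :=
  beta1 + k%:R ^+ 2 * (k%:R ^+ 2 - 1) / h ^+ 2 * beta2
  - 2 * k%:R ^+ 2 / h * (alpha1 ^+ 2 + beta1 * beta2 + 1 / 4).

Definition Lambda : R :=
  - (2 * k%:R / h) * (alpha1 ^+ 2 + beta1 * beta2 - 1 / 4).

Definition c2 : R := 2 * k%:R * alpha1 / h.

Definition b1 : R :=
  - beta1 - k%:R ^+ 2 * (k%:R ^+ 2 + 1) / h ^+ 2 * beta2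
  + 2 * k%:R ^+ 2 / h * (alpha1 ^+ 2 + beta1 * beta2 + 1 / 4).

Definition b2 : R :=
  - (2 * k%:R ^+ 3 / h ^+ 2 * beta2)
  + 2 * k%:R / h * (alpha1 ^+ 2 + beta1 * beta2 + 1 / 4).

(* The branch of sqrt (Gamma^2 - Lambda^2) used when |Gamma| < |Lambda|. *)
Definition sqrtGL : R[i] := 0 +i* Num.sqrt (Lambda ^+ 2 - Gamma ^+ 2).

Definition lambda1 : R[i] :=
  ((-1) ^+ k.+1 / Lambda)%:C * (Gamma%:C + sqrtGL).

Definition Q1 : 'M[R[i]]_2 :=
  (2 * sqrtGL)^-1 *:
  \matrix_(i < 2, j < 2)
    (nth [::] [:: [:: c2%:C + sqrtGL; (b1 + b2)%:C];
                  [:: (b1 - b2)%:C; - c2%:C + sqrtGL]] i)`_j.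

Definition V1 : 'cV[R[i]]_2 :=
  \col_(i < 2)
    (Lambda^-1 *
     [:: - beta1 + k%:R * (k%:R + 1) / h *
                   ((1 / 2 - alpha1) ^+ 2 + beta1 * beta2);
         beta1 - k%:R * (k%:R - 1) / h *
                 ((1 / 2 - alpha1) ^+ 2 + beta1 * beta2)]`_i)%:C.

Definition V2 : 'cV[R[i]]_2 :=
  \col_(i < 2) ([:: - (h / (2 * k%:R)); h / (2 * k%:R)]`_i)%:C.

End Quantities.

Definition cmod (R : realType) (z : R[i]) : R := complex.Re `|z|.

Definition vnorm_oo (R : realType) (n : nat) (v : 'cV[R[i]]_n) : R :=
  \big[Num.max/0]_(i < n) cmod (v i 0).

Definition mnorm_oo (R : realType) (n : nat) (A : 'M[R[i]]_n) : R :=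
  sup [set vnorm_oo (A *m v) | v in [set v | vnorm_oo v <= 1]].

(* Main.v *)
(* Let q be the local projection of u: on each cell it has the moments of u up
   to degree k - 2, the value of u at the right end point and the derivative of
   u at the left one.  On a cell, E = w - q is orthogonal to polynomials of
   degree k - 2, hence is a combination (lo, hi) of the Legendre polynomials of
   degrees k - 1 and k, whose end point values and derivatives are explicit.
   The interface conditions become
     e_j = M e_(j+1) + (u - q)^+ V1 + (u - q)_x^- V2,   e_j = (lo_j, hi_j),
   where Q1 M = lambda1 Q1 and |lambda1| = 1.  Hence Y_j = Q1 e_j solves a
   scalar cyclic recurrence, (1 - lambda1^N) Y_j is a sum of N = (b - a) / h
   terms of modulus at most ||Q1|| times the sources, and e_j = 2 Re Y_j since
   Q1 - 1/2 is purely imaginary.  The sources u - q are bounded by Taylor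
   expansion, once u is known to be a C^k function whose k-th derivative is a
   primitive of the weak derivative of order k + 1. *)
Require Import Defs.
From HB Require Import structures.
From mathcomp Require Import all_boot all_order all_algebra.
From mathcomp Require Import all_classical all_reals all_analysis.
From mathcomp Require Import measurable_realfun ess_sup_inf complex.
From mathcomp Require polyrcf.
From mathcomp Require Import ring lra.
Set Implicit Arguments.
Unset Strict Implicit.
Unset Printing Implicit Defensive.
Import Order.TTheory GRing.Theory Num.Theory.
Import numFieldNormedType.Exports.
Local Open Scope classical_set_scope.
Local Open Scope ring_scope.

(** * Weak derivatives *)

(** The end point conditions on $q$ are chosen so that only $(u-q)^+$ and $(u-q)_x^-$ survive at an
    interface. Solving the two interface conditions for $e_j$, a linear system of determinant
    $\Lambda$, turns their coefficients into exactly $V_1$ and $V_2$. No Legendre polynomial is ever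
    constructed: polynomials orthogonal to degree $k-2$ are split by parity under $x\mapsto 1-x$,
    and each part is an eigenvector of the Legendre operator, which reduces to $\pm p'$ at the end
    points. One has $M=\frac{(-1)^{k+1}}{\Lambda}(\Gamma+A)$ with $A$ real of trace zero and
    $A^2=\Gamma^2-\Lambda^2<0$. Its eigenvalues are therefore $\lambda_1$ and $\bar\lambda_1$, and
    $Q_1$ and $\bar Q_1$ are the two spectral projectors. Since $|\lambda_1|=1$, nothing decays
    along the mesh and the $N$ sources simply add up: this gives one $h^{-1}$ of $h^{-(\delta'+1)}$,
    the division by $|1-\lambda_1^N|$ gives the rest. The $h^{-1}$ before $\|V_2\|_\infty$ is the
    order lost by a source that is a derivative. *)

Lemma is_derive_quadratic_error (R : realType) (f : R -> R) (x l C : R) :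
  (forall h, `|f (x + h) - f x - l * h| <= C * h ^+ 2) -> is_derive x 1 f l.
Proof.
move=> H.
have C0 : 0 <= C by have := le_trans (normr_ge0 _) (H 1); rewrite expr1n mulr1.
suff K : (fun h => h^-1 *: (f (h *: 1 + x) - f x)) @ 0^' --> l.
  by split; [apply/cvg_ex; exists l | exact/cvg_lim].
apply/cvgrPdist_le => e e0.
near=> h.
have h0 : h != 0 by near: h; exact: nbhs_dnbhs_neq.
have hh : 0 < `|h| by rewrite normr_gt0.
rewrite /GRing.scale /= mulr1 [h + x]addrC.
have -> : l - h^-1 * (f (x + h) - f x) = - (h^-1 * (f (x + h) - f x - l * h)).
  by field.
rewrite normrN normrM normfV ler_pdivrMl//.
apply: (le_trans (H h)); rewrite -(real_normK (num_real h)) expr2 mulrA mulrC.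
rewrite ler_wpM2l//.
have : `|h| <= e / (C + 1).
  near: h; apply: dnbhs0_le; rewrite divr_gt0// ltr_wpDl//.
rewrite ler_pdivlMr ?ltr_wpDl//; apply: le_trans.
by rewrite mulrC ler_wpM2l// lerDl.
Unshelve. all: by end_near. Qed.

(** * A piecewise quadratic $C^1$ step function *)

Section Step.
Variable R : realType.
Implicit Types x y : R.

Definition pos_part y : R := Num.max 0 y.

Lemma pos_part_cases y : (0 <= y /\ pos_part y = y) \/ (y <= 0 /\ pos_part y = 0).
Proof.
rewrite /pos_part; case: (leP 0 y) => h; first by left.
by right; split=> //; exact: ltW.
Qed.

(** In every sign pattern of [x] and [x + h] the first-order remainder is at most $h^2$, so the kink
    at 0 needs no separate treatment. *)
Lemma is_derive_pos_part_sqr x :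
  is_derive x 1 (fun y => pos_part y ^+ 2) (2 * pos_part x).
Proof.
apply: (@is_derive_quadratic_error _ _ _ _ 1) => h.
rewrite ler_norml.
case: (pos_part_cases (x + h)) => -[h1 ->];
case: (pos_part_cases x) => -[h2 ->]; apply/andP; split; nra.
Qed.

Lemma continuous_pos_part : continuous pos_part.
Proof.
move=> x; apply: continuous_max; [exact: cst_continuous | exact: cvg_id].
Qed.

(* The second difference of [pos_part ^+ 2] is a C^1 step from 0 (at 0) to
   1 (at 1), whose derivative is the tent [tent] of unit mass. *)
Definition step y : R :=
  2 * (pos_part y ^+ 2 - 2 * pos_part (y - 2^-1) ^+ 2 + pos_part (y - 1) ^+ 2).
Definition tent y : R :=
  4 * (pos_part y - 2 * pos_part (y - 2^-1) + pos_part (y - 1)).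

Lemma is_derive_step x : is_derive x 1 step (tent x).
Proof.
have H c : is_derive x 1 (fun y => pos_part (y - c) ^+ 2) (2 * pos_part (x - c)).
  have := @is_derive1_comp _ (fun y => pos_part y ^+ 2) (fun y => y - c) x _ _
    (is_derive_pos_part_sqr (x - c)) (is_deriveB (is_derive_id x 1) (is_derive_cst c x 1)).
  by rewrite subr0 mulr1.
have H0 := H 0; rewrite subr0 in H0.
have -> : step = 2 \*: ((fun y => pos_part (y - 0) ^+ 2)
   - (2 \*: (fun y => pos_part (y - 2^-1) ^+ 2)) + (fun y => pos_part (y - 1) ^+ 2)).
  by apply/funext => y; rewrite /step !fctE /GRing.scale/= subr0.
apply: is_derive_eq.
by rewrite /tent /GRing.scale /=; ring.
Qed.

Lemma continuous_tent : continuous tent.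
Proof.
move=> x; apply: cvgM; first exact: cvg_cst.
apply: cvgD; last first.
  apply: (@continuous_comp _ _ _ (fun y => y - 1) pos_part); last exact: continuous_pos_part.
  by apply: cvgB; [exact: cvg_id | exact: cvg_cst].
apply: cvgB; first exact: continuous_pos_part.
apply: cvgM; first exact: cvg_cst.
apply: (@continuous_comp _ _ _ (fun y => y - 2^-1) pos_part); last exact: continuous_pos_part.
by apply: cvgB; [exact: cvg_id | exact: cvg_cst].
Qed.

Lemma step_le0 y : y <= 0 -> step y = 0.
Proof.
move=> h; rewrite /step.
case: (pos_part_cases y) => -[h1 ->]; case: (pos_part_cases (y - 2^-1)) => -[h2 ->];
case: (pos_part_cases (y - 1)) => -[h3 ->]; nra.
Qed.

Lemma step_ge1 y : 1 <= y -> step y = 1.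
Proof.
move=> h; rewrite /step.
case: (pos_part_cases y) => -[h1 ->]; case: (pos_part_cases (y - 2^-1)) => -[h2 ->];
case: (pos_part_cases (y - 1)) => -[h3 ->]; nra.
Qed.

Lemma step_itv y : 0 <= step y <= 1.
Proof.
rewrite /step.
case: (pos_part_cases y) => -[h1 ->]; case: (pos_part_cases (y - 2^-1)) => -[h2 ->];
case: (pos_part_cases (y - 1)) => -[h3 ->]; apply/andP; split; nra.
Qed.

Lemma tent_out y : y <= 0 \/ 1 <= y -> tent y = 0.
Proof.
rewrite /tent => h.
case: (pos_part_cases y) => -[h1 ->]; case: (pos_part_cases (y - 2^-1)) => -[h2 ->];
case: (pos_part_cases (y - 1)) => -[h3 ->]; case: h; lra.
Qed.

Lemma tent_itv y : 0 <= tent y <= 2.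
Proof.
rewrite /tent.
case: (pos_part_cases y) => -[h1 ->]; case: (pos_part_cases (y - 2^-1)) => -[h2 ->];
case: (pos_part_cases (y - 1)) => -[h3 ->]; apply/andP; split; lra.
Qed.

Lemma is_derive_step_scale (s e x : R) :
  is_derive x 1 (fun y => step ((y - s) / e)) (tent ((x - s) / e) / e).
Proof.
apply: (@is_derive1_comp _ step (fun y => (y - s) / e)).
  exact: is_derive_step.
have -> : (fun y => (y - s) / e) = e^-1 \*: (id - cst s).
  by apply/funext => y; rewrite !fctE /GRing.scale /= mulrC.
by apply: is_derive_eq; rewrite subr0 /GRing.scale/= mulr1.
Qed.

Lemma continuous_tent_scale (s e : R) : continuous (fun y => tent ((y - s) / e) / e).
Proof.
move=> x; apply: cvgMl; apply: (@continuous_comp _ _ _ (fun y => (y - s) / e) tent).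
  by apply: cvgMl; apply: cvgB; [exact: cvg_id | exact: cvg_cst].
exact: continuous_tent.
Qed.

End Step.

(** * Essentially bounded functions and averages at Lebesgue points *)

Section LebesgueBounds.
Variable R : realType.
Local Notation mu := (@lebesgue_measure R).

Lemma lebesgue_measure_setT_gt0 : (0 < mu [set: R])%E.
Proof. by rewrite -set_itvNyy lebesgue_measure_itv/= ltry. Qed.

Lemma Linfty_ae_bounded (f : R -> R) : is_Linfty f ->
  measurable_fun [set: measurableTypeR R] f /\
  exists2 M, 0 <= M & \forall x \ae mu, `|f x| <= M.
Proof.
case/andP; rewrite !inE /= => mf fin; split=> //.
move: fin; rewrite /finite_norm unlock /Lnorm; case: ifPn; last first.
  by rewrite lebesgue_measure_setT_gt0.
move=> _ fin.
have ge0 : (0 <= ess_sup mu (abse \o (EFin \o f)))%E.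
  apply: ess_sup_gee; first exact: lebesgue_measure_setT_gt0.
  by apply/nearW => x /=; rewrite lee_fin.
have /fineK K : ess_sup mu (abse \o (EFin \o f)) \is a fin_num.
  by rewrite ge0_fin_numE.
exists (fine (ess_sup mu (abse \o (EFin \o f)))); first exact: fine_ge0.
apply: filterS (ess_sup_ge mu (abse \o (EFin \o f))).
by move=> x /=; rewrite -{1}K lee_fin.
Qed.

Lemma ae_bounded_integrable (A : set (measurableTypeR R)) (f : R -> R) (M : R) :
  measurable A -> (mu A < +oo)%E -> measurable_fun A f -> 0 <= M ->
  (\forall x \ae mu, A x -> `|f x| <= M) ->
  mu.-integrable A (EFin \o f).
Proof.
move=> mA fA mf M0 fM; apply/integrableP; split; first exact/measurable_EFinP.
have h : (\int[mu]_(x in A) `|(EFin \o f) x| <= M%:E * mu A)%E.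
  apply: integral_le_bound => //; first exact/measurable_EFinP.
apply: (le_lt_trans h); rewrite lte_mul_pinfty// ?lee_fin//.
Qed.

Lemma ae_bounded_Rintegral (A : set (measurableTypeR R)) (f : R -> R) (M : R) :
  measurable A -> (mu A < +oo)%E -> measurable_fun A f -> 0 <= M ->
  (\forall x \ae mu, A x -> `|f x| <= M) ->
  `|\int[mu]_(x in A) f x| <= M * fine (mu A).
Proof.
move=> mA fA mf M0 fM.
have int := ae_bounded_integrable mA fA mf M0 fM.
rewrite -lee_fin EFin_normr_Rintegral// EFinM fineK ?ge0_fin_numE//.
apply: le_trans (le_abse_integral mu mA _) _; first exact/measurable_EFinP.
by apply: integral_le_bound => //; exact/measurable_EFinP.
Qed.

Lemma Rintegral_supp (A : set (measurableTypeR R)) (f : R -> R) :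
  (forall x, ~ A x -> f x = 0) -> \int[mu]_x f x = \int[mu]_(x in A) f x.
Proof.
move=> h; rewrite [RHS]Rintegral_mkcond; apply: eq_Rintegral => x _.
by rewrite patchE; case: ifPn => //; rewrite notin_setE => /h.
Qed.

Lemma integrable_supp (A : set (measurableTypeR R)) (f : R -> R) : measurable A ->
  (forall x, ~ A x -> f x = 0) -> mu.-integrable A (EFin \o f) ->
  mu.-integrable setT (EFin \o f).
Proof.
move=> mA h i; have := (@integrable_mkcond _ (measurableTypeR R) _ mu _ (EFin \o f) mA).1 i; congr integrable.
apply/funext => x; rewrite patchE; case: ifPn => //.
by rewrite notin_setE => /h /= ->.
Qed.

Lemma ae_all (P : set R) : (forall x, P x) -> \forall x \ae mu, P x.
Proof.
move=> h; apply: (@filterS _ _ (ae_filter_ringOfSetsType mu) setT) => //.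
exact: (@filterT _ _ (ae_filter_ringOfSetsType mu)).
Qed.

Lemma ae_sub (P Q : set R) : P `<=` Q ->
  (\forall x \ae mu, P x) -> \forall x \ae mu, Q x.
Proof. exact: (@filterS _ _ (ae_filter_ringOfSetsType mu)). Qed.

Lemma itvcc_lty (s t : R) : (mu `[s, t] < +oo)%E.
Proof.
by rewrite lebesgue_measure_itv/=; case: ifP => // _; rewrite -EFinB ltry.
Qed.

(** Unit mass at every scale [e] makes the rescaled tents an approximate identity at [s]. *)
Lemma Rintegral_tent (s e : R) : 0 < e ->
  \int[mu]_x (tent ((x - s) / e) / e) = 1.
Proof.
move=> e0; rewrite (@Rintegral_supp `[s, s + e]); last first.
  move=> x /= /negP; rewrite in_itv /= negb_and -!ltNge => h.
  rewrite tent_out ?mul0r//; case/orP: h => h.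
    by left; rewrite pmulr_lle0 ?invr_gt0// subr_le0 ltW.
  by right; rewrite ler_pdivlMr// mul1r lerBrDl ltW.
rewrite /Rintegral (@continuous_FTC2 _ _ (fun x => step ((x - s) / e))).
- by rewrite subrr mul0r (step_le0 (lexx _)) [s + e - s]addrAC subrr add0r divff ?gt_eqF// step_ge1//= subr0.
- by rewrite ltrDl.
- by apply: continuous_subspaceT; exact: continuous_tent_scale.
- have H x := is_derive_step_scale s e x.
  have C x : {for x, continuous (fun x => step ((x - s) / e))}.
    by apply/differentiable_continuous/derivable1_diffP.
  split; [by move=> x _ | exact/cvg_at_right_filter/C | exact/cvg_at_left_filter/C].
- by move=> x _; rewrite derive1E; case: (is_derive_step_scale s e x).
Qed.

(** The tent of width [d] is bounded by $2/d$ and vanishes outside the ball of radius [d], of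
    measure $2d$. The error is thus at most 4 times the mean oscillation [davg u s d], which tends
    to 0 at a Lebesgue point; hence the threshold [e / 4]. Integrability is included because two
    such integrals are later subtracted. *)
Lemma tent_average_lebesgue_pt (u : R -> R) (s M : R) :
  measurable_fun [set: measurableTypeR R] u -> 0 <= M -> (\forall x \ae mu, `|u x| <= M) ->
  lebesgue_pt u s ->
  forall e, 0 < e -> \forall d \near 0^'+,
    mu.-integrable setT (EFin \o (fun x => u x * (tent ((x - s) / d) / d))) /\
    `|\int[mu]_x (u x * (tent ((x - s) / d) / d)) - u s| <= e.
Proof.
move=> mu_ M0 uM us e e0.
have /fine_cvgP[_ /cvgrPdist_le/(_ (e / 4))] := us.
rewrite divr_gt0// => /(_ isT) near_avg.
near=> d.
have d0 : 0 < d by near: d; exact: nbhs_right_gt.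
have avg : `|0 - fine (davg u s d)| <= e / 4 by near: d; exact: near_avg.
pose T x : R := tent ((x - s) / d) / d.
have mT (A : set (measurableTypeR R)) : measurable_fun A T.
  apply: (@measurable_funS _ _ _ _ setT) => //.
  by apply: continuous_measurable_fun; exact: continuous_tent_scale.
have mB : measurable (ball s d : set (measurableTypeR R)) by exact: measurable_ball.
have muB : mu (ball s d) = (d *+ 2)%:E by rewrite lebesgue_measure_ball// ltW.
have fB : (mu (ball s d) < +oo)%E by rewrite muB ltry.
have T0 x : ~ ball s d x -> T x = 0.
  rewrite /ball /= => /negP; rewrite -leNgt => h.
  rewrite /T tent_out ?mul0r//.
  have [xs|xs] := leP x s.
    by left; rewrite pmulr_lle0 ?invr_gt0// subr_le0.
  right; rewrite ler_pdivlMr// mul1r; move: h.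
  by rewrite distrC gtr0_norm// subr_gt0.
have Tb x : 0 <= T x <= 2 / d.
  rewrite /T; have /andP[h1 h2] := tent_itv ((x - s) / d).
  by rewrite divr_ge0// ?(ltW d0)//= ler_pM2r ?invr_gt0.
have T20 : 0 <= 2 / d by rewrite divr_ge0// ltW.
have nT x : `|T x| <= 2 / d by have /andP[h1 h2] := Tb x; rewrite ger0_norm.
have iT : mu.-integrable (ball s d) (EFin \o T).
  by apply: (@ae_bounded_integrable _ _ (2 / d)) => //; apply: ae_all => x _.
have mu' : measurable_fun (ball s d) u by exact: measurable_funS mu_.
have iuT : mu.-integrable (ball s d) (EFin \o (fun x => u x * T x)).
  apply: (@ae_bounded_integrable _ _ (M * (2 / d))) => //.
  - by apply: measurable_funM.
  - by rewrite mulr_ge0.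
  - by apply: ae_sub uM => x h _; rewrite normrM ler_pM.
have iusT : mu.-integrable (ball s d) (EFin \o (fun x => u s * T x)).
  apply: (@ae_bounded_integrable _ _ (`|u s| * (2 / d))) => //.
  - by apply: measurable_funM.
  - by rewrite mulr_ge0.
  - by apply: ae_all => x _; rewrite normrM ler_pM.
have idu : mu.-integrable (ball s d) (EFin \o (fun x => 2 / d * `|u x - u s|)).
  apply: (@ae_bounded_integrable _ _ (2 / d * (M + `|u s|))) => //.
  - by apply: measurable_funM => //; apply: measurableT_comp => //; exact: measurable_funB.
  - by rewrite mulr_ge0// addr_ge0.
  - apply: ae_sub uM => x h _; rewrite normrM normr_id (ger0_norm T20).
    by rewrite ler_wpM2l// (le_trans (ler_normB _ _))// lerD2r.
have idu1 : mu.-integrable (ball s d) (EFin \o (fun x => `|u x - u s|)).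
  apply: (@ae_bounded_integrable _ _ (M + `|u s|)) => //.
  - by apply: measurableT_comp => //; exact: measurable_funB.
  - by rewrite addr_ge0.
  - apply: ae_sub uM => x h _; rewrite normr_id.
    by rewrite (le_trans (ler_normB _ _))// lerD2r.
have supp x : ~ ball s d x -> u x * T x = 0 by move=> /T0 ->; rewrite mulr0.
split; first exact: (integrable_supp mB supp).
rewrite (Rintegral_supp supp).
have -> : u s = \int[mu]_(x in ball s d) (u s * T x).
  rewrite RintegralZl// -(Rintegral_supp T0) /T Rintegral_tent// mulr1//.
rewrite -RintegralB//.
have int_d : mu.-integrable (ball s d) (EFin \o (fun x => u x * T x - u s * T x)).
  by have := integrableB mB iuT iusT.
apply: (le_trans (le_normr_Rintegral mB int_d)).
apply: (@le_trans _ _ (\int[mu]_(x in ball s d) (2 / d * `|u x - u s|))).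
  apply: le_Rintegral => //.
    have := integrable_norm int_d; exact.
  by move=> x _; rewrite -mulrBl normrM mulrC ler_wpM2r.
rewrite RintegralZl//.
have -> : \int[mu]_(x in ball s d) `|u x - u s| = fine (davg u s d) * (d *+ 2).
  rewrite /davg /iavg muB.
  have fi : (\int[mu]_(y in ball s d) `|(((center (u s)) \o u) y)%:E|)%E \is a fin_num.
    exact: (integrable_fin_num mB idu1).
  rewrite inver mulrn_eq0/= gt_eqF// fineM// /= mulrAC mulVf ?mul1r//.
  by rewrite mulrn_eq0/= gt_eqF.
have fd : 0 <= fine (davg u s d) by apply/fine_ge0/davg_ge0.
rewrite sub0r normrN ger0_norm// in avg.
have -> : 2 / d * (fine (davg u s d) * (d *+ 2)) = 4 * fine (davg u s d).
  by field; rewrite gt_eqF.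
lra.
Unshelve. all: by end_near. Qed.

End LebesgueBounds.

(** * Test functions close to the indicator of an interval *)

Section WeakDerivative.
Variable R : realType.
Local Notation mu := (@lebesgue_measure R).

Lemma notin_itvcc (s t x : R) : ~ `[s, t]%classic x -> x < s \/ t < x.
Proof.
move=> /= /negP; rewrite in_itv /= negb_and -!ltNge => /orP[]; [by left|by right].
Qed.

(** The bump approximates the indicator of $[s,t]$, and its derivative is an approximate Dirac mass
    at [s] minus one at [t]. Testing a weak derivative with it gives the fundamental theorem of
    calculus as [d] tends to 0. *)
Lemma step_bump_C1c (s t d : R) : s < t -> 0 < d ->
  let phi x := step ((x - s) / d) - step ((x - t) / d) in
  C1c phi /\
  derive1 phi = (fun x => tent ((x - s) / d) / d - tent ((x - t) / d) / d).
Proof.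
move=> st d0 phi.
have D (x : R) : is_derive x 1 phi (tent ((x - s) / d) / d - tent ((x - t) / d) / d).
  by apply: is_deriveB; exact: is_derive_step_scale.
have E : derive1 phi = (fun x => tent ((x - s) / d) / d - tent ((x - t) / d) / d).
  by apply/funext => x; rewrite derive1E; case: (D x).
split=> //; split.
- by move=> x.
- by rewrite E => x; apply: cvgB; exact: continuous_tent_scale.
- exists (`|s| + `|t| + d) => x; rewrite ltr_normr /phi => /orP[] h.
    have h1 : t + d <= x.
      by apply/ltW/(le_lt_trans _ h); rewrite lerD2r (le_trans (ler_norm t))// lerDr.
    rewrite !step_ge1 ?subrr// ler_pdivlMr// mul1r; lra.
have h1 : x <= s.
  have := ler_norm (- s); rewrite normrN => hs.
  by have := normr_ge0 t; lra.
rewrite !step_le0 ?subrr// pmulr_lle0 ?invr_gt0//; lra.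
Qed.

(** The bump differs from the indicator of $[s,t]$ only on $[s,s+d]\cup[t,t+d]$, of measure at most
    $2d$, and by at most 1 there. *)
Lemma step_bump_approx (v : R -> R) (M s t d : R) :
  measurable_fun [set: measurableTypeR R] v -> 0 <= M -> (\forall x \ae mu, `|v x| <= M) ->
  s < t -> 0 < d ->
  `|\int[mu]_x (v x * (step ((x - s) / d) - step ((x - t) / d)))
    - \int[mu]_(x in `[s, t]) v x| <= M * (d *+ 2).
Proof.
move=> mv M0 vM st d0.
set phi : R -> R := fun x => step ((x - s) / d) - step ((x - t) / d).
change (`|\int[mu]_x (v x * phi x) - \int[mu]_(x in `[s, t]) v x| <= M * (d *+ 2)).
have [phiC _] := step_bump_C1c st d0; rewrite -/phi in phiC.
have mphi : measurable_fun [set: measurableTypeR R] phi.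
  by apply: continuous_measurable_fun => x; case: phiC => + _ _; move/(_ x)/derivable1_diffP/differentiable_continuous.
have bphi x : `|phi x| <= 1.
  have /andP[? ?] := step_itv ((x - s) / d); have /andP[? ?] := step_itv ((x - t) / d).
  by rewrite ler_norml /phi; apply/andP; split; lra.
pose I : set (measurableTypeR R) := `[s, t]%classic.
have mI : measurable I by exact: measurable_itv.
pose D : set (measurableTypeR R) := `[s, s + d]%classic `|` `[t, t + d]%classic.
have mD : measurable D by apply: measurableU; exact: measurable_itv.
have muD : (mu D <= (d *+ 2)%:E)%E.
  have h : (mu D <= mu `[s, (s + d)%R]%classic + mu `[t, (t + d)%R]%classic)%E.
    by apply: measureU2; exact: measurable_itv.
  apply: (le_trans h).
  by rewrite !lebesgue_measure_itv /= !lte_fin !ltrDl d0 -!EFinB -EFinD lee_fin; lra.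
have fD : (mu D < +oo)%E by apply: (le_lt_trans muD); exact: ltry.
have phi0 x : ~ `[s, t + d]%classic x -> phi x = 0.
  move/notin_itvcc => [h|h].
    rewrite /phi !step_le0 ?subrr// pmulr_lle0 ?invr_gt0//; lra.
  rewrite /phi !step_ge1 ?subrr// ler_pdivlMr// mul1r; lra.
have iphi : mu.-integrable setT (EFin \o (fun x => v x * phi x)).
  apply: (@integrable_supp _ `[s, t + d]%classic); first exact: measurable_itv.
    by move=> x /phi0 ->; rewrite mulr0.
  apply: (@ae_bounded_integrable _ _ _ M) => //.
  - exact: itvcc_lty.
  - by apply: measurable_funTS; exact: measurable_funM.
  - by apply: ae_sub vM => x h _; rewrite normrM -[M]mulr1 ler_pM.
pose vI : R -> R := v \_ I.
have mvI : measurable_fun [set: measurableTypeR R] vI.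
  by apply/(measurable_restrictT _ mI); exact: measurable_funS mv.
have vI0 x : ~ I x -> vI x = 0.
  by move=> h; rewrite /vI patchE; case: ifPn => // /set_mem.
have iI : mu.-integrable setT (EFin \o vI).
  apply: (integrable_supp mI vI0).
  apply: (@ae_bounded_integrable _ _ _ M) => //; first exact: itvcc_lty.
    exact: measurable_funS mvI.
  by apply: ae_sub vM => x h xI; rewrite /vI patchE mem_set.
have -> : \int[mu]_(x in `[s, t]) v x = \int[mu]_x vI x.
  by rewrite Rintegral_mkcond.
rewrite -RintegralB//.
have supp x : ~ D x -> v x * phi x - vI x = 0.
  rewrite /D => /= /not_orP[/notin_itvcc hs /notin_itvcc ht].
  rewrite /vI patchE; case: ifPn => [/set_mem|/negP h].
    rewrite /I /= in_itv /= => /andP[sx xt].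
    have h1 : s + d < x by case: hs => //; rewrite ltNge sx.
    case: ht => [xt'|]; last by move=> ?; lra.
    rewrite /phi step_ge1 ?step_le0; first by rewrite subr0 mulr1 subrr.
      by rewrite pmulr_lle0 ?invr_gt0//; lra.
    by rewrite ler_pdivlMr// mul1r; lra.
  have {}h : ~ `[s, t]%classic x by move=> xI; apply: h; exact: mem_set.
  rewrite subr0 phi0 ?mulr0// => /=; rewrite in_itv/= => /andP[sx xtd].
  move/notin_itvcc: h => [|tx]; first by lra.
  by case: ht; lra.
rewrite (Rintegral_supp supp).
apply: (@le_trans _ _ (M * fine (mu D))).
  apply: ae_bounded_Rintegral => //.
    by apply: measurable_funTS; apply: measurable_funB => //; exact: measurable_funM.
  apply: ae_sub vM => x h _; rewrite /vI patchE; case: ifPn => [/set_mem|_].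
    rewrite /I /= in_itv /= => /andP[sx xt].
    rewrite -{2}[v x]mulr1 -mulrBr normrM -[M]mulr1 ler_pM//.
    have /andP[? ?] := step_itv ((x - s) / d).
    rewrite ler_norml /phi (@step_le0 _ ((x - t) / d)); first by lra.
    by rewrite pmulr_lle0 ?invr_gt0//; lra.
  by rewrite subr0 normrM -[M]mulr1 ler_pM.
rewrite ler_wpM2l// -lee_fin fineK// ge0_fin_numE//.
Qed.

End WeakDerivative.

(** * Continuous representatives as primitives of weak derivatives *)

Section WeakPrimitive.
Variable R : realType.
Local Notation mu := (@lebesgue_measure R).

Lemma Linfty_locally_integrable (f : R -> R) :
  is_Linfty f -> locally_integrable setT f.
Proof.
case/Linfty_ae_bounded => mf [M M0 fM]; split => //; first exact: openT.
move=> K _ cK; have mK := compact_measurable cK.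
have : mu.-integrable K (EFin \o f).
  apply: (@ae_bounded_integrable _ _ _ M) => //.
  - exact: compact_finite_measure.
  - exact: measurable_funTS.
  - by apply: ae_sub fM.
by case/integrableP.
Qed.

Lemma Linfty_integrable (v : R -> R) (s t : R) : is_Linfty v ->
  mu.-integrable `[s, t] (EFin \o v).
Proof.
case/Linfty_ae_bounded => mv [M M0 vM].
apply: (@ae_bounded_integrable _ _ _ M) => //.
- exact: itvcc_lty.
- exact: measurable_funTS.
- by apply: ae_sub vM.
Qed.

(** The weak derivative is tested against the bump at a small scale [d]. The tent averages at [s]
    and [t] cost [e / 4] each, the replacement of the bump by the indicator costs [e / 2]. *)
Lemma weak_deriv_lebesgue_pt (u v : R -> R) (s t : R) :
  is_Linfty u -> is_Linfty v -> weak_deriv u v -> s < t ->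
  lebesgue_pt u s -> lebesgue_pt u t ->
  u t - u s = \int[mu]_(x in `[s, t]) v x.
Proof.
move=> /Linfty_ae_bounded[mu_ [Mu Mu0 uM]] /Linfty_ae_bounded[mv [M M0 vM]] uv st us ut.
apply/eqP; rewrite -subr_eq0 -normr_le0; apply/ler_addgt0Pl => e e0; rewrite addr0.
have e4 : 0 < e / 4 by rewrite divr_gt0.
have ns := tent_average_lebesgue_pt mu_ Mu0 uM us e4.
have nt := tent_average_lebesgue_pt mu_ Mu0 uM ut e4.
near (0 : R)^'+ => d.
have d0 : 0 < d by near: d; exact: nbhs_right_gt.
have [is_ hs] : mu.-integrable setT (EFin \o (fun x => u x * (tent ((x - s) / d) / d))) /\
    `|\int[mu]_x (u x * (tent ((x - s) / d) / d)) - u s| <= e / 4.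
  by near: d; exact: ns.
have [it_ ht] : mu.-integrable setT (EFin \o (fun x => u x * (tent ((x - t) / d) / d))) /\
    `|\int[mu]_x (u x * (tent ((x - t) / d) / d)) - u t| <= e / 4.
  by near: d; exact: nt.
have hd : d <= e / 4 / (M + 1).
  by near: d; apply: nbhs_right_le; rewrite divr_gt0// ltr_wpDl.
have {}hd : M * (d *+ 2) <= e / 2.
  move: hd; rewrite ler_pdivlMr ?ltr_wpDl// => hd; nra.
have [phiC dphi] := step_bump_C1c st d0.
have := uv _ phiC; rewrite dphi.
have -> : \int[mu]_x (u x * (tent ((x - s) / d) / d - tent ((x - t) / d) / d)) =
   \int[mu]_x (u x * (tent ((x - s) / d) / d)) -
   \int[mu]_x (u x * (tent ((x - t) / d) / d)).
  by rewrite -RintegralB//; apply: eq_Rintegral => x _; rewrite mulrBr.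
have := step_bump_approx mv M0 vM st d0.
move: hs ht; set A := Rintegral _ _ _; set B := Rintegral _ _ _.
set C := Rintegral _ _ _; set D := Rintegral _ _ _.
rewrite !ler_norml => /andP[? ?] /andP[? ?] /andP[? ?] ?.
apply/andP; split; lra.
Unshelve. all: by end_near. Qed.

Lemma Rintegral_itv_add (v : R -> R) (r s t : R) : is_Linfty v ->
  r <= s -> s <= t ->
  \int[mu]_(x in `[r, t]) v x =
  \int[mu]_(x in `[r, s]) v x + \int[mu]_(x in `[s, t]) v x.
Proof.
move=> vL rs st.
have := @Rintegral_itvB R v (BLeft r) (BRight t) s (Linfty_integrable _ _ vL).
rewrite !bnd_simp => /(_ rs st) => h.
rewrite -(@Rintegral_itv_obnd_cbnd _ s (BRight t)) -?h; first by rewrite addrC subrK.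
apply: integrableS (Linfty_integrable s t vL) => //.
by apply: subset_itvr; rewrite bnd_simp.
Qed.

Lemma ae_exists (P : set R) : (\forall x \ae mu, P x) -> exists x, P x.
Proof.
move=> aeP; apply: contrapT => nP.
have /(@filter_ex _ _ (ae_properfilter_algebraOfSetsType _)) [] :
  \forall x \ae mu, False.
- by apply: ae_sub aeP => x Px; apply: nP; exists x.
- exact: lebesgue_measure_setT_gt0.
- by [].
Qed.

(** One Lebesgue point [p] of [u] serves as base point of the signed integral of [v]. Almost every
    [x] is a Lebesgue point too, and there the increment of [u] from [p] is that integral. *)
Lemma weak_deriv_primitive (u v : R -> R) :
  is_Linfty u -> is_Linfty v -> weak_deriv u v ->
  exists U : R -> R, (\forall x \ae mu, u x = U x) /\
    forall s t, s <= t -> U t - U s = \int[mu]_(x in `[s, t]) v x.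
Proof.
move=> uL vL uv.
have leb := lebesgue_differentiation (Linfty_locally_integrable uL).
have [p pL] := ae_exists leb.
pose I s t := \int[mu]_(x in `[s, t]) v x.
have Iadd r s t : r <= s -> s <= t -> I r t = I r s + I s t.
  exact: Rintegral_itv_add.
have I0 r : I r r = 0.
  by rewrite /I set_itv1 Rintegral_set1.
pose U x := u p + (if p <= x then I p x else - I x p).
exists U; split.
  apply: ae_sub leb => x xL; rewrite /U.
  have [px|xp|<-] := ltgtP p x.
  - by rewrite /I -(weak_deriv_lebesgue_pt uL vL uv px pL xL); lra.
  - by rewrite /I -(weak_deriv_lebesgue_pt uL vL uv xp xL pL); lra.
  - by rewrite I0 addr0.
move=> s t st; rewrite -/(I s t) /U.
have [ps|sp] := leP p s.
  by rewrite (le_trans ps st) (Iadd p s t)//; lra.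
have [pt|tp] := leP p t.
  by rewrite (Iadd s p t)//; [lra | exact: ltW].
by rewrite (Iadd s t p)//; [lra | exact: ltW].
Qed.

Lemma ae_eq_continuous (f g : R -> R) : continuous f -> continuous g ->
  (\forall x \ae mu, f x = g x) -> f = g.
Proof.
move=> cf cg [N [mN N0 sub]]; apply/funext => x; apply: contrapT => fgx.
have cx : {for x, continuous (fun y => f y - g y)} by apply: cvgB; [exact: cf|exact: cg].
have n0 : `|f x - g x| > 0 by rewrite normr_gt0 subr_eq0; apply/eqP.
have /cvgrPdist_lt/(_ _ n0) := cx.
rewrite -filter_from_norm_nbhs => -[e /= e0 be].
have sB : ball x e `<=` N.
  move=> y xy; apply: sub => /= fgy.
  have := be y xy; rewrite /= fgy subrr subr0 ltxx //.
have mB : measurable (ball x e : set (measurableTypeR R)) by exact: measurable_ball.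
have : (mu (ball x e) <= mu N)%E by apply: le_measure; rewrite ?inE.
rewrite N0 lebesgue_measure_ball ?(ltW e0)// lee_fin.
by rewrite leNgt mulrn_wgt0.
Qed.

End WeakPrimitive.

(** * Polynomials on the unit interval *)

Section UnitIntegral.
Variable R : rcfType.
Implicit Types p q r v : {poly R}.

Lemma size_le_pred p (n : nat) : (size p <= n.+1)%N -> p`_n = 0 -> (size p <= n)%N.
Proof.
move=> /leq_sizeP sp pn; apply/leq_sizeP => j.
by rewrite leq_eqVlt => /predU1P[<-//|]; exact: sp.
Qed.

(** At index 0 the coefficient is a division by zero, hence 0: this is the primitive that vanishes
    at 0. *)
Definition poly_prim p : {poly R} := \poly_(i < (size p).+1) (p`_i.-1 / i%:R).

Lemma coef_poly_prim p i : (poly_prim p)`_i = p`_i.-1 / i%:R.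
Proof.
rewrite coef_poly; case: ltnP => //; case: i => [//|i] /= h.
by rewrite nth_default ?mul0r.
Qed.

Lemma size_poly_prim p : (size (poly_prim p) <= (size p).+1)%N.
Proof. exact: size_poly. Qed.

Lemma poly_prim_deriv p : (poly_prim p)^`() = p.
Proof.
apply/polyP => i; rewrite coef_deriv coef_poly_prim /= -(mulr_natr (_ / _)).
by rewrite divfK ?pnatr_eq0.
Qed.

Lemma horner0_poly_prim p : (poly_prim p).[0] = 0.
Proof. by rewrite horner_coef0 coef_poly_prim invr0 mulr0. Qed.

(** Integration over $[0,1]$ done algebraically; [Rintegral_itvoo_poly] relates it to the Lebesgue
    integral. *)
Definition unit_int p : R := (poly_prim p).[1].

Lemma unit_intD p q : unit_int (p + q) = unit_int p + unit_int q.
Proof.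
rewrite /unit_int -hornerD; congr _.[_]; apply/polyP => i.
by rewrite coefD !coef_poly_prim coefD mulrDl.
Qed.

Lemma unit_intZ c p : unit_int (c *: p) = c * unit_int p.
Proof.
rewrite /unit_int -hornerZ; congr _.[_]; apply/polyP => i.
by rewrite coefZ !coef_poly_prim coefZ mulrA.
Qed.

Lemma unit_intN p : unit_int (- p) = - unit_int p.
Proof. by rewrite -scaleN1r unit_intZ mulN1r. Qed.

Lemma unit_intB p q : unit_int (p - q) = unit_int p - unit_int q.
Proof. by rewrite unit_intD unit_intN. Qed.

Lemma unit_int0 : unit_int 0 = 0.
Proof. by rewrite -(scale0r 0) unit_intZ mul0r. Qed.

Lemma unit_int_sum (I : Type) (s : seq I) (P : pred I) (F : I -> {poly R}) :
  unit_int (\sum_(i <- s | P i) F i) = \sum_(i <- s | P i) unit_int (F i).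
Proof. exact: (big_morph _ unit_intD unit_int0). Qed.

Lemma unit_int_deriv p : unit_int p^`() = p.[1] - p.[0].
Proof.
have -> : p = poly_prim p^`() + (p`_0)%:P.
  apply/polyP => -[|i]; rewrite coefD coef_poly_prim coefC /=.
    by rewrite invr0 mulr0 add0r.
  by rewrite coef_deriv addr0 -(mulr_natr p`_i.+1) mulfK// pnatr_eq0.
rewrite derivD derivC addr0 poly_prim_deriv !hornerD !hornerC horner0_poly_prim.
by rewrite /unit_int; ring.
Qed.

(** The primitive is nondecreasing on $[0,1]$ and takes the value 0 at both ends, so it vanishes on
    the whole interval and is the zero polynomial. *)
Lemma unit_int_ge0_eq0 q :
  (forall x, 0 <= x <= 1 -> 0 <= q.[x]) -> unit_int q = 0 -> q = 0.
Proof.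
move=> q0 Iq; have mono x y : 0 <= x -> x <= y -> y <= 1 ->
    (poly_prim q).[x] <= (poly_prim q).[y].
  move=> x0; rewrite le_eqVlt => /predU1P[->//|xy] y1.
  have [c] := polyrcf.poly_mvt (poly_prim q) xy.
  rewrite in_itv /= poly_prim_deriv => /andP[xc cy] h.
  rewrite -subr_ge0 h mulr_ge0 ?subr_ge0 ?(ltW xy)// q0//.
  by rewrite (le_trans x0 (ltW xc)) (le_trans (ltW cy)).
have P0 x : 0 <= x <= 1 -> (poly_prim q).[x] = 0.
  move=> /andP[x0 x1]; apply/eqP; rewrite eq_le -{1}Iq mono//=.
  by rewrite -(horner0_poly_prim q) mono.
rewrite -[q]poly_prim_deriv; suff -> : poly_prim q = 0 by rewrite deriv0.
apply/eqP; apply: contraT => Pn0.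
(* The distinct points $1/(i+1)$ of $[0,1]$ supply more roots than the degree allows. *)
pose s := [seq (i.+1%:R : R)^-1 | i <- iota 0 (size (poly_prim q))].
have := @max_poly_roots _ _ s Pn0.
rewrite size_map size_iota ltnn; apply.
  apply/allP => _ /mapP[i _ ->]; apply/rootP/P0.
  by rewrite invr_ge0 ler0n /= invf_le1 ?ltr0n// ler1n.
rewrite map_inj_uniq ?iota_uniq// => i j /invr_inj/eqP.
by rewrite eqr_nat => /eqP [].
Qed.

(** The symmetry of $[0,1]$ for which shifted Legendre polynomials are alternately even and odd. *)
Definition reflp p : {poly R} := p \Po (1 - 'X).

Lemma horner_reflp p x : (reflp p).[x] = p.[1 - x].
Proof. by rewrite horner_comp !hornerE. Qed.

Lemma reflpK p : reflp (reflp p) = p.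
Proof.
rewrite /reflp -comp_polyA.
by rewrite comp_polyB comp_polyC comp_polyX opprB addrC subrK comp_polyXr.
Qed.

Lemma deriv_reflp p : (reflp p)^`() = - reflp p^`().
Proof. by rewrite /reflp deriv_comp derivB derivC derivX sub0r mulrN1. Qed.

Lemma unit_int_reflp p : unit_int (reflp p) = unit_int p.
Proof.
rewrite -{1}[p]poly_prim_deriv -[reflp _]opprK -deriv_reflp unit_intN unit_int_deriv.
by rewrite !horner_reflp subrr subr0 horner0_poly_prim sub0r opprK.
Qed.

Lemma size_1subX : size (1 - 'X : {poly R}) = 2.
Proof. by rewrite -opprB size_polyN size_XsubC. Qed.

Lemma size_reflp p : size (reflp p) = size p.
Proof. by rewrite size_comp_poly2 ?size_1subX. Qed.

Lemma coef_reflp p n : (size p <= n.+1)%N -> (reflp p)`_n = (-1) ^+ n * p`_n.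
Proof.
move=> sp; have [sn|sn] := leqP (size p) n.
  by rewrite !nth_default ?size_reflp// mulr0.
have {sn}sp : size p = n.+1 by apply/eqP; rewrite eqn_leq sp.
have : lead_coef (reflp p) = lead_coef p * lead_coef (1 - 'X : {poly R}) ^+ (size p).-1.
  by apply: lead_coef_comp; rewrite size_1subX.
rewrite !lead_coefE size_reflp sp size_1subX /=.
by rewrite coefB coefX coef1 /= sub0r mulrC.
Qed.

(* The shifted Legendre polynomial of degree [m] is an eigenvector for the
   eigenvalue [- m (m + 1)]. *)
Definition legendre_op p : {poly R} := (('X - 'X^2) * p^`())^`().

Lemma legendre_opE p :
  legendre_op p = (1 - 2 *: 'X) * p^`() + ('X - 'X^2) * p^`()^`().
Proof.
rewrite /legendre_op derivM derivB derivX derivXn /=.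
by rewrite expr1 -scaler_nat.
Qed.

(** The weight $x-x^2$ vanishes at both ends, so only the first-order term is left there. End point
    derivatives of an eigenvector can thus be read off its end point values. *)
Lemma legendre_op0 p : (legendre_op p).[0] = p^`().[0].
Proof. by rewrite legendre_opE !hornerE/= expr0n /=; ring. Qed.

Lemma legendre_op1 p : (legendre_op p).[1] = - p^`().[1].
Proof. by rewrite legendre_opE !hornerE/= expr1n /=; ring. Qed.

(** The operator is triangular in the monomial basis, so the top coefficient already shows the
    eigenvalue. *)
Lemma coef_legendre_op p n : (size p <= n.+1)%N ->
  (legendre_op p)`_n = - (n%:R * (n%:R + 1)) * p`_n.
Proof.
move=> /leq_sizeP sp; rewrite coef_deriv mulrBl coefB coefXM coefXnM /=.
rewrite !coef_deriv (sp n.+1)// mul0rn sub0r.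
case: n {sp} => [|n] /=; first by rewrite oppr0 mul0rn !mul0r oppr0 mul0r.
rewrite subSS subn1 /= -(mulr_natr p`_n.+1) -(mulr_natr (- _)).
by ring.
Qed.

Lemma size_legendre_op p n : (size p <= n)%N -> (size (legendre_op p) <= n)%N.
Proof.
move=> sp; apply/leq_sizeP => j nj.
by rewrite coef_legendre_op ?nth_default ?mulr0 ?(leq_trans sp)// (leq_trans nj).
Qed.

(** Self-adjointness: the two integrands differ by the derivative of $x-x^2$ times a Wronskian,
    which is zero at both ends. *)
Lemma unit_int_legendre_op p q :
  unit_int (legendre_op p * q) = unit_int (p * legendre_op q).
Proof.
apply/eqP; rewrite -subr_eq0 -unit_intB.
have -> : legendre_op p * q - p * legendre_op q =
    (('X - 'X^2) * (p^`() * q - p * q^`()))^`().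
  rewrite !legendre_opE derivM derivB [(_ * q - _)^`()]derivB !derivM.
  by rewrite !derivX -!mul_polyC; ring.
by rewrite unit_int_deriv !hornerM !hornerD !hornerN !hornerXn !hornerX expr1n expr0n subrr subr0 !mul0r subrr.
Qed.

Lemma legendre_op_reflp p : legendre_op (reflp p) = reflp (legendre_op p).
Proof.
rewrite /legendre_op deriv_reflp mulrN.
have sym : reflp ('X - 'X^2) = 'X - 'X^2.
  by rewrite /reflp expr2 comp_polyB comp_polyM !comp_polyX; ring.
by rewrite -{1}sym -[reflp _ * reflp _]comp_polyM -/(reflp _) derivN deriv_reflp opprK.
Qed.

Lemma legendre_opD p q : legendre_op (p + q) = legendre_op p + legendre_op q.
Proof. by rewrite /legendre_op derivD mulrDr derivD. Qed.

Lemma legendre_opZ c p : legendre_op (c *: p) = c *: legendre_op p.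
Proof. by rewrite /legendre_op derivZ -scalerAr derivZ. Qed.

End UnitIntegral.

(** * Polynomials of degree $k$ orthogonal to those of degree $k-2$ *)

Section LegendrePair.
Variable R : rcfType.
Implicit Types p q r v : {poly R}.

(* The span of the Legendre polynomials of degrees [k - 1] and [k]. *)
Definition legendre_pair (k : nat) r :=
  (size r <= k.+1)%N /\
  forall v, (size v <= k.-1)%N -> unit_int (r * v) = 0.

Lemma legendre_pair_lin k r1 r2 (a b : R) :
  legendre_pair k r1 -> legendre_pair k r2 ->
  legendre_pair k (a *: r1 + b *: r2).
Proof.
move=> [s1 o1] [s2 o2]; split.
  rewrite (leq_trans (size_polyD _ _))// geq_max.
  by rewrite !(leq_trans (size_scale_leq _ _)).
move=> v sv; rewrite mulrDl -!scalerAl unit_intD !unit_intZ o1// o2//.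
by rewrite !mulr0 addr0.
Qed.

Lemma legendre_pair_reflp k r : legendre_pair k r -> legendre_pair k (reflp r).
Proof.
move=> [s o]; split; first by rewrite size_reflp.
move=> v sv; rewrite -[v]reflpK -[_ * _]comp_polyM -/(reflp _) unit_int_reflp.
by rewrite o// size_reflp.
Qed.

(** Reflection multiplies the coefficient of degree [n] by $(-1)^n$, while parity [m] multiplies it
    by $(-1)^m$, the opposite sign. *)
Lemma coef_parity_eq0 (m : nat) r n : reflp r = (-1) ^+ m *: r ->
  odd (m + n) -> (size r <= n.+1)%N -> r`_n = 0.
Proof.
move=> rm mn sr; have := coef_reflp sr.
rewrite rm coefZ.
have -> : (-1) ^+ m = - (-1) ^+ n :> R.
  rewrite -(signr_odd R m) -(signr_odd R n).
  by move: mn; rewrite oddD; case: (odd m); case: (odd n) => //= _; rewrite ?expr0 ?expr1 ?opprK.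
rewrite mulNr => /eqP; rewrite -subr_eq0 -opprD oppr_eq0 -mulr2n -mulr_natl.
by rewrite !mulf_eq0 pnatr_eq0 signr_eq0 /= => /eqP.
Qed.

(** Of the residual [s], the coefficient of degree [m] vanishes by the choice of the eigenvalue and
    the other one among the degrees $k-1$ and $k$ by parity. So [s] has degree at most $k-2$, and it
    is then orthogonal to itself. *)
Lemma legendre_pair_eigen (k m : nat) r : (0 < k)%N ->
  m = k \/ m = k.-1 -> legendre_pair k r -> reflp r = (-1) ^+ m *: r ->
  legendre_op r = - (m%:R * (m%:R + 1)) *: r.
Proof.
move=> k0 mk [sr orth] par.
pose s := legendre_op r + (m%:R * (m%:R + 1)) *: r.
suff : s = 0 by move/eqP; rewrite addr_eq0 => /eqP; rewrite scaleNr.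
have spar : reflp s = (-1) ^+ m *: s.
  rewrite /s {1}/reflp comp_polyD comp_polyZ -!/(reflp _) -legendre_op_reflp par.
  by rewrite legendre_opZ scalerDr !scalerA [in LHS]mulrC.
have ss n : (size r <= n)%N -> (size s <= n)%N.
  move=> h; rewrite (leq_trans (size_polyD _ _))// geq_max size_legendre_op//=.
  by rewrite (leq_trans (size_scale_leq _ _)).
have stop : (size r <= m.+1)%N -> s`_m = 0.
  by move=> h; rewrite coefD coefZ coef_legendre_op// mulNr addNr.
have sk1 : (size s <= k.-1)%N.
  case: mk => mk.
    have h : (size s <= k)%N by rewrite size_le_pred ?ss// -mk stop// mk.
    rewrite size_le_pred ?prednK//.
    apply: (coef_parity_eq0 spar); last by rewrite prednK.
    by rewrite mk -{1}(prednK k0) addSn addnn /= odd_double.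
  have sr' : (size r <= k)%N.
    rewrite size_le_pred// (coef_parity_eq0 par)//.
    by rewrite mk -{2}(prednK k0) addnS addnn /= odd_double.
  by rewrite size_le_pred ?prednK ?ss// -mk stop// mk prednK.
(* Self-adjointness moves the operator from [r] to [s], whose degree does not grow, so both terms
   are pairings of [r] with a polynomial of degree at most $k-2$. *)
have : unit_int (s * s) = 0.
  rewrite {1}/s mulrDl -scalerAl unit_intD unit_intZ orth//.
  by rewrite unit_int_legendre_op orth ?size_legendre_op// mulr0 addr0.
move=> /unit_int_ge0_eq0 h; apply/eqP; rewrite -sqrf_eq0 expr2 h// => x _.
by rewrite hornerM -expr2 sqr_ge0.
Qed.

(* Coordinates of [r] on the Legendre polynomials of degrees [k - 1] and [k],
   normalized to take the value 1 at 1 (they take [(-1)^(k - 1)] and [(-1)^k]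
   at 0). *)
Definition leg_lo (k : nat) r : R := (r.[1] + (-1) ^+ k.+1 * r.[0]) / 2.
Definition leg_hi (k : nat) r : R := (r.[1] - (-1) ^+ k.+1 * r.[0]) / 2.

Lemma legendre_pair_horner1 k r : r.[1] = leg_lo k r + leg_hi k r.
Proof. by rewrite /leg_lo /leg_hi; field. Qed.

Lemma legendre_pair_horner0 k r :
  r.[0] = (-1) ^+ k.+1 * (leg_lo k r - leg_hi k r).
Proof.
have ee := sqrr_sign R k.+1; rewrite /leg_lo /leg_hi.
by transitivity (((-1) ^+ k.+1) ^+ 2 * r.[0]); [rewrite ee mul1r | field].
Qed.

(** The parts [r1] and [r2] of parity $k-1$ and $k$ stay in the span, so they have eigenvalues
    $-(k-1)k$ and $-k(k+1)$. At the end points the operator is the derivative up to sign. *)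
Lemma legendre_pair_deriv k r : (0 < k)%N -> legendre_pair k r ->
  r^`().[1] = k%:R * (k%:R - 1) * leg_lo k r + k%:R * (k%:R + 1) * leg_hi k r /\
  r^`().[0] = (-1) ^+ k.+1 *
    (- (k%:R * (k%:R - 1)) * leg_lo k r + k%:R * (k%:R + 1) * leg_hi k r).
Proof.
(* The sign is made opaque, so that [ring] and [field] see a variable [e] and only $e^2=1$ is
   used. *)
move=> k0 Hr; have [e eE] : exists e : R, (-1) ^+ k.+1 = e by eexists.
have ee : e * e = 1 by rewrite -eE -expr2 sqrr_sign.
pose r1 := 2^-1 *: r + (e / 2) *: reflp r.
pose r2 := 2^-1 *: r + (- e / 2) *: reflp r.
have rE : r = r1 + r2.
  rewrite /r1 /r2 mulNr scaleNr addrACA subrr addr0 -scalerDl.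
  by rewrite -{1}[r]scale1r; congr (_ *: _); field.
have H1 : legendre_pair k r1 by apply: legendre_pair_lin => //; exact: legendre_pair_reflp.
have H2 : legendre_pair k r2 by apply: legendre_pair_lin => //; exact: legendre_pair_reflp.
have p1 : reflp r1 = (-1) ^+ k.-1 *: r1.
  have -> : (-1) ^+ k.-1 = e by rewrite -eE -{2}(prednK k0) !exprS; ring.
  rewrite /r1 scalerDr !scalerA mulrA ee addrC /reflp comp_polyD !comp_polyZ -!/(reflp _) reflpK.
  by rewrite mul1r.
have p2 : reflp r2 = (-1) ^+ k *: r2.
  have -> : (-1) ^+ k = - e by rewrite -eE exprS mulN1r opprK.
  rewrite /r2 scalerDr !scalerA mulrA mulrNN ee addrC /reflp comp_polyD !comp_polyZ -!/(reflp _) reflpK.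
  by rewrite mul1r.
have E1 := legendre_pair_eigen k0 (or_intror erefl) H1 p1.
have E2 := legendre_pair_eigen k0 (or_introl erefl) H2 p2.
have k1 : k.-1%:R = k%:R - 1 :> R by rewrite -subn1 natrB.
have h1 x : r1.[x] = 2^-1 * r.[x] + e / 2 * r.[1 - x].
  by rewrite /r1 hornerD !hornerZ horner_reflp.
have h2 x : r2.[x] = 2^-1 * r.[x] + - e / 2 * r.[1 - x].
  by rewrite /r2 hornerD !hornerZ horner_reflp.
have L1 : r1.[1] = leg_lo k r by rewrite h1 subrr /leg_lo eE; field.
have L2 : r2.[1] = leg_hi k r by rewrite h2 subrr /leg_hi eE; field.
have M1 : r1.[0] = e * leg_lo k r.
  rewrite h1 subr0 /leg_lo eE.
  by transitivity ((e * e * r.[0] + e * r.[1]) / 2); [rewrite ee | ]; field.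
have M2 : r2.[0] = - e * leg_hi k r.
  rewrite h2 subr0 /leg_hi eE.
  by transitivity ((e * e * r.[0] - e * r.[1]) / 2); [rewrite ee | ]; field.
rewrite eE; split.
  rewrite -[LHS]opprK -legendre_op1 rE legendre_opD E1 E2 hornerD !hornerZ -rE L1 L2 k1.
  by ring.
rewrite -legendre_op0 rE legendre_opD E1 E2 hornerD !hornerZ -rE M1 M2 k1.
by ring.
Qed.

(** The two conditions give $lo=-hi$ and $2k^2\,hi=0$, so [r] vanishes at both ends and equals
    $-v(x-x^2)$ with $v$ of degree at most $k-2$. Orthogonality to $v$ then annihilates the integral
    of $v^2(x-x^2)$. *)
Lemma legendre_pair_inj k r : (0 < k)%N -> legendre_pair k r ->
  r.[1] = 0 -> r^`().[0] = 0 -> r = 0.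
Proof.
move=> k0 Hr r1 dr0; have [_] := legendre_pair_deriv k0 Hr.
rewrite dr0 => /esym/eqP; rewrite mulf_eq0 signr_eq0 /= => /eqP h.
have h1 : leg_lo k r = - leg_hi k r.
  by apply/eqP; rewrite -addr_eq0 -legendre_pair_horner1 r1.
have h2 : leg_hi k r = 0.
  apply: (@mulfI _ (2 * k%:R ^+ 2)); last by rewrite mulr0 -h h1; ring.
  by rewrite mulf_neq0 ?expf_neq0 ?pnatr_eq0 -?lt0n.
have r0 : r.[0] = 0 by rewrite (legendre_pair_horner0 k) h1 h2 !oppr0 addr0 mulr0.
have /factor_theorem[q rq] : root r 0 by apply/rootP.
have /factor_theorem[v qv] : root q 1.
  apply/rootP; move: r1; rewrite rq !hornerE; lra.
case: (eqVneq v 0) => [v0|v0]; first by rewrite rq qv v0 !mul0r.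
have rE : r = - (v * ('X - 'X^2)).
  by rewrite rq qv subr0; ring.
case: Hr => sr orth.
have sv : (size v <= k.-1)%N.
  move: sr; rewrite rq qv !size_mul ?mulf_neq0 ?polyXsubC_eq0// !size_XsubC !addn2 /= ltnS.
  by case: (k) k0.
have := orth v sv; rewrite rE mulNr unit_intN => /eqP; rewrite oppr_eq0 => /eqP.
move/unit_int_ge0_eq0 => H0.
have /eqP : v * ('X - 'X^2) * v = 0.
  apply: H0 => x /andP[x0 x1]; rewrite !hornerM !hornerE.
  by rewrite mulrAC -expr2 mulr_ge0 ?sqr_ge0//; nra.
by rewrite mulf_eq0 (negPf v0) orbF => /eqP ->; rewrite oppr0.
Qed.

(* The degrees of freedom defining the local projection on the unit interval. *)
Definition local_dof (k : nat) r (j : nat) : R :=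
  if (j < k.-1)%N then unit_int (r * 'X^j)
  else if j == k.-1 then r.[1] else r^`().[0].

Lemma local_dofD k p q j : local_dof k (p + q) j = local_dof k p j + local_dof k q j.
Proof.
by rewrite /local_dof mulrDl unit_intD derivD !hornerD; case: ifP => // _; case: ifP.
Qed.

Lemma local_dofZ k c p j : local_dof k (c *: p) j = c * local_dof k p j.
Proof.
by rewrite /local_dof -scalerAl unit_intZ derivZ !hornerZ; case: ifP => // _; case: ifP.
Qed.

Lemma local_dofB k p q j : local_dof k (p - q) j = local_dof k p j - local_dof k q j.
Proof. by rewrite -scaleN1r local_dofD local_dofZ mulN1r. Qed.

Lemma local_dof_sum k (n : nat) (F : 'I_n -> {poly R}) j :
  local_dof k (\sum_i F i) j = \sum_i local_dof k (F i) j.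
Proof.
apply: (big_morph (fun p => local_dof k p j) (fun p q => local_dofD k p q j)).
by rewrite -(scale0r 0) local_dofZ mul0r.
Qed.

Lemma local_dof_legendre_pair k r : (size r <= k.+1)%N ->
  (forall j, (j < k.-1)%N -> local_dof k r j = 0) -> legendre_pair k r.
Proof.
move=> sr h; split=> // v sv.
rewrite -[v]coefK poly_def mulr_sumr unit_int_sum big1// => i _.
rewrite -scalerAr unit_intZ; have iv : (i < k.-1)%N := leq_trans (ltn_ord i) sv.
by have := h i iv; rewrite /local_dof iv => ->; rewrite mulr0.
Qed.

End LegendrePair.

(** * Unisolvence and stability of the local degrees of freedom *)

Section LocalDof.
Variable R : rcfType.
Implicit Types p r : {poly R}.

Definition local_dof_mx (k : nat) : 'M[R]_k.+1 :=
  \matrix_(i < k.+1, j < k.+1) local_dof k 'X^i j.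

Lemma local_dof_mxE k r : (size r <= k.+1)%N ->
  (\row_(i < k.+1) r`_i) *m local_dof_mx k = \row_(j < k.+1) local_dof k r j.
Proof.
move=> sr; apply/rowP => j; rewrite !mxE.
have rE : r = \sum_(i < k.+1) r`_i *: 'X^i.
  rewrite -poly_def; apply/polyP => i; rewrite coef_poly; case: ltnP => // h.
  by rewrite nth_default// (leq_trans sr).
rewrite [in RHS]rE local_dof_sum; apply: eq_bigr => i _.
by rewrite !mxE local_dofZ.
Qed.

(** A kernel element has vanishing moments up to degree $k-2$, so it lies in the Legendre pair and
    [legendre_pair_inj] applies. *)
Lemma local_dof_mx_unit k : (0 < k)%N -> local_dof_mx k \in unitmx.
Proof.
move=> k0; rewrite -row_free_unit; apply: inj_row_free => v v0.
pose r : {poly R} := \poly_(i < k.+1) v 0 (inord i).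
have sr : (size r <= k.+1)%N by exact: size_poly.
have vr : v = \row_(i < k.+1) r`_i.
  by apply/rowP => i; rewrite mxE coef_poly ltn_ord inord_val.
have dof0 (j : nat) : (j < k.+1)%N -> local_dof k r j = 0.
  move=> jk; have := local_dof_mxE sr; rewrite -vr v0.
  by move/rowP/(_ (Ordinal jk)); rewrite !mxE.
suff r0 : r = 0 by rewrite vr r0; apply/rowP => i; rewrite !mxE coef0.
apply: (legendre_pair_inj k0).
- by apply: local_dof_legendre_pair => // j jk; rewrite dof0// (ltn_trans jk)// ltnS leq_pred.
- have := dof0 k.-1; rewrite /local_dof ltnn eqxx; apply.
  by rewrite ltnS leq_pred.
- have := dof0 k (leqnn _); rewrite /local_dof ltnNge leq_pred /=.
  by rewrite gtn_eqF// prednK.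
Qed.

Lemma local_dof_surj k (d : nat -> R) : (0 < k)%N ->
  exists2 r : {poly R}, (size r <= k.+1)%N &
    forall j, (j < k.+1)%N -> local_dof k r j = d j.
Proof.
move=> k0; pose v := (\row_(j < k.+1) d j) *m invmx (local_dof_mx k).
pose r : {poly R} := \poly_(i < k.+1) v 0 (inord i).
have sr : (size r <= k.+1)%N by exact: size_poly.
exists r => // j jk.
have vr : v = \row_(i < k.+1) r`_i.
  by apply/rowP => i; rewrite [RHS]mxE coef_poly ltn_ord inord_val.
have := local_dof_mxE sr; rewrite -vr mulmxKV ?local_dof_mx_unit//.
by move/rowP/(_ (Ordinal jk)); rewrite !mxE.
Qed.

(** The constant is read off the inverse matrix on the unit interval, so it depends on [k] only and
    not on the cell. The added 1 makes it positive. *)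
Lemma coef_le_local_dof k : (0 < k)%N -> exists2 K : R, 0 < K &
  forall (r : {poly R}) (D : R), (size r <= k.+1)%N ->
    (forall j, (j < k.+1)%N -> `|local_dof k r j| <= D) ->
    forall i, `|r`_i| <= K * D.
Proof.
move=> k0; pose A := invmx (local_dof_mx k).
exists (1 + \sum_(i < k.+1) \sum_(j < k.+1) `|A j i|).
  by rewrite ltr_wpDr// sumr_ge0// => i _; rewrite sumr_ge0.
move=> r D sr dof i.
have D0 : 0 <= D by exact: le_trans (normr_ge0 _) (dof 0 isT).
have S0 (i' : 'I_k.+1) : 0 <= \sum_(j < k.+1) `|A j i'| by rewrite sumr_ge0.
have [ik|ik] := ltnP i k.+1; last first.
  rewrite nth_default ?(leq_trans sr)// normr0 mulr_ge0// addr_ge0// sumr_ge0//.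
have -> : r`_i = \sum_(j < k.+1) local_dof k r j * A j (Ordinal ik).
  have := local_dof_mxE sr => /(congr1 (mulmx^~ A)).
  rewrite mulmxK ?local_dof_mx_unit// => /rowP/(_ (Ordinal ik)).
  by rewrite !mxE => ->; apply: eq_bigr => j _; rewrite mxE.
apply: (@le_trans _ _ ((\sum_(j < k.+1) `|A j (Ordinal ik)|) * D)).
  rewrite (le_trans (ler_norm_sum _ _ _))// mulr_suml ler_sum// => j _.
  by rewrite normrM mulrC ler_wpM2l// dof.
rewrite ler_wpM2r// [X in 1 + X](bigD1 (Ordinal ik))//= addrCA lerDl addr_ge0//.
by rewrite sumr_ge0.
Qed.

Lemma horner_unit_le r n (B x : R) : (size r <= n)%N -> 0 <= x <= 1 -> 0 <= B ->
  (forall i, `|r`_i| <= B) -> `|r.[x]| <= n%:R * B.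
Proof.
move=> sr /andP[x0 x1] B0 rB; rewrite (horner_coef_wide _ sr).
rewrite (le_trans (ler_norm_sum _ _ _))//.
rewrite -[n in n%:R]card_ord mulr_natl -sumr_const ler_sum// => i _.
rewrite normrM normrX (ger0_norm x0) -[B]mulr1 ler_pM// ?exprn_ge0//.
exact: exprn_ile1.
Qed.

Lemma coef_deriv_le r n (B : R) : (size r <= n)%N -> 0 <= B ->
  (forall i, `|r`_i| <= B) -> forall i, `|r^`()`_i| <= n%:R * B.
Proof.
move=> sr B0 rB i; rewrite coef_deriv normrMn -(mulr_natl `|_|).
have [ni|ni] := leqP n i.+1.
  by rewrite nth_default ?(leq_trans sr)// normr0 mulr0 mulr_ge0.
by rewrite ler_pM// ler_nat ltnW.
Qed.

Lemma horner_le_local_dof k : (0 < k)%N -> exists2 K : R, 0 < K &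
  forall (r : {poly R}) (D : R), (size r <= k.+1)%N ->
    (forall j, (j < k.+1)%N -> `|local_dof k r j| <= D) ->
    forall x, 0 <= x <= 1 -> `|r.[x]| <= K * D /\ `|r^`().[x]| <= K * D.
Proof.
move=> /coef_le_local_dof[K K0 HK]; exists (k.+1%:R * (k.+1%:R * K)).
  by rewrite !mulr_gt0// ltr0n.
move=> r D sr dof x x01; have D0 : 0 <= D by exact: le_trans (normr_ge0 _) (dof 0 isT).
have KD0 : 0 <= K * D by rewrite mulr_ge0// ltW.
have cr := HK r D sr dof; split; last first.
  rewrite -!mulrA; apply: horner_unit_le => //.
  - apply/leq_sizeP => j jk.
    by rewrite coef_deriv nth_default ?mul0rn// (leq_trans sr)// (leq_trans jk).
  - by rewrite mulr_ge0.
  - exact: coef_deriv_le.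
rewrite (le_trans (horner_unit_le sr x01 KD0 cr))// -mulrA ler_wpM2l//.
by rewrite -mulrA ler_peMl// ler1n.
Qed.

(** All moments vanish; the remaining degrees of freedom $r(1)$ and $r'(0)$ are at most $2D$ and
    $2k^2D$, hence the factor $2+2k^2$. *)
Lemma legendre_pair_le k : (0 < k)%N -> exists2 K : R, 0 < K &
  forall (r : {poly R}) (D : R), legendre_pair k r -> `|leg_lo k r| <= D -> `|leg_hi k r| <= D ->
    forall x, 0 <= x <= 1 -> `|r.[x]| <= K * D.
Proof.
move=> k0; have [K K0 HK] := horner_le_local_dof k0.
exists (K * (2 + 2 * k%:R ^+ 2)).
  by rewrite mulr_gt0// ltr_wpDr// mulr_ge0// exprn_ge0.
move=> r D Hr lo hi x x01.
have D0 : 0 <= D by exact: le_trans lo.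
rewrite -mulrA; apply: (HK r _ _ _ _ x01).1; first by case: Hr.
have kk : 0 <= 2 * k%:R ^+ 2 * D by rewrite !mulr_ge0// exprn_ge0.
move=> j jk; rewrite /local_dof; case: ifP => [jk1|_].
  by case: Hr => _ ->; rewrite ?size_polyXn// normr0 mulr_ge0// addr_ge0// mulr_ge0// exprn_ge0.
case: ifP => _.
  rewrite (legendre_pair_horner1 k) mulrDl (le_trans (ler_normD _ _))//; lra.
rewrite (legendre_pair_deriv k0 Hr).2 normrMsign.
have a0 : 0 <= k%:R * (k%:R - 1) :> R by rewrite mulr_ge0// subr_ge0 ler1n.
have b0 : 0 <= k%:R * (k%:R + 1) :> R by rewrite mulr_ge0// addr_ge0.
rewrite (le_trans (ler_normD _ _))// mulNr normrN.
rewrite (normrM _ (leg_lo k r)) (normrM _ (leg_hi k r)) (ger0_norm a0) (ger0_norm b0).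
have := ler_wpM2l a0 lo; have := ler_wpM2l b0 hi; lra.
Qed.

End LocalDof.

(** * Taylor estimates and the local projection *)

Section WeakTaylor.
Variable R : realType.
Local Notation mu := (@lebesgue_measure R).

Lemma mean_value_le (f df : R -> R) (c x B : R) : c <= x ->
  (forall y : R, is_derive y 1 f (df y)) ->
  (forall y, c <= y <= x -> `|df y| <= B) ->
  `|f x - f c| <= B * (x - c).
Proof.
move=> cx dff dfB.
have [|y] := @MVT_segment R f df c x cx (fun y _ => dff y).
  apply: derivable_within_continuous => y _; exact: ex_derive.
by rewrite in_itv /= => /dfB yB ->; rewrite normrM (ger0_norm (_ : 0 <= x - c)) ?subr_ge0// ler_wpM2r ?subr_ge0.
Qed.

Lemma increment_is_derive (U w : R -> R) : continuous w ->
  (forall s t, s <= t -> U t - U s = \int[mu]_(x in `[s, t]) w x) ->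
  forall x : R, is_derive x 1 U (w x).
Proof.
move=> cw Uw x.
(* Any base point to the left of [x] would do: changing it alters the primitive by a constant. *)
have xx : x - 1 < x by rewrite ltrBlDr ltrDl.
have iw : mu.-integrable `[x - 1, x + 1] (EFin \o w).
  apply: continuous_compact_integrable; first exact: segment_compact.
  exact: continuous_subspaceT.
have x1 : x < x + 1 by rewrite ltrDl.
have [] := @continuous_FTC1_closed R w (x - 1) x (x + 1) x1 iw xx (cw x).
set F := fun y => _ => dF dFE.
have FE : \forall y \near x, (F + cst (U (x - 1))) y = U y.
  near=> y; rewrite /F !fctE /= -Uw ?subrK//.
  by apply/ltW; near: y; exact: lt_nbhsr.
have dF' : is_derive x 1 F (w x).
  by apply: (DeriveDef dF); rewrite -derive1E dFE.
have : is_derive x 1 (F + cst (U (x - 1))) (w x).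
  by apply: is_derive_eq; rewrite addr0.
exact: near_eq_is_derive.
Unshelve. all: by end_near. Qed.

Lemma increment_continuous (U : R -> R) (M : R) : 0 <= M ->
  (forall s t, s <= t -> `|U t - U s| <= M * (t - s)) -> continuous U.
Proof.
move=> M0 UM x; apply/cvgrPdist_le => e e0.
have eM : 0 < e / (M + 1) by rewrite divr_gt0// ltr_wpDl.
have nearx : \forall y \near x, `|x - y| <= e / (M + 1).
  by have /cvgrPdist_le := @cvg_id _ (nbhs x); exact.
near=> y.
have UM' : `|U x - U y| <= M * `|x - y|.
  have [xy|/ltW yx] := leP x y.
    rewrite (distrC (U x)) (distrC x) [leRHS](_ : _ = M * (y - x)) ?UM//.
    by rewrite ger0_norm ?subr_ge0.
  by rewrite [leRHS](_ : _ = M * (x - y)) ?UM// ger0_norm ?subr_ge0.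
apply: (le_trans UM').
have : `|x - y| <= e / (M + 1) by near: y.
by rewrite ler_pdivlMr ?ltr_wpDl// => h; have := normr_ge0 (x - y); nra.
Unshelve. all: by end_near. Qed.

Lemma Rintegral_le_ae (g : R -> R) (a b M s t : R) : is_Linfty g -> 0 <= M ->
  (\forall x \ae mu, `[a, b]%classic x -> `|g x| <= M) ->
  a <= s -> s <= t -> t <= b ->
  `|\int[mu]_(x in `[s, t]) g x| <= M * (t - s).
Proof.
move=> /Linfty_ae_bounded[mg _] M0 gM as_ st tb.
have := @ae_bounded_Rintegral R `[s, t]%classic g M.
rewrite lebesgue_measure_itv /= lte_fin.
have -> : fine (if (s < t)%R then (t%:E - s%:E)%E else 0%E) = t - s.
  by case: ltP => // ts; apply/esym/eqP; rewrite /= subr_eq0 eq_le ts.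
apply => //.
- by case: ifP => // _; rewrite -EFinB ltry.
- exact: measurable_funTS.
- apply: ae_sub gM => x h /=; rewrite in_itv /= => /andP[sx xt].
  by apply: h; rewrite /= in_itv /= (le_trans as_)// (le_trans xt).
Qed.

Lemma ae_eq_Rintegral_itv (f g : R -> R) (s t : R) : is_Linfty f ->
  continuous g -> (\forall x \ae mu, f x = g x) ->
  \int[mu]_(x in `[s, t]) f x = \int[mu]_(x in `[s, t]) g x.
Proof.
move=> /Linfty_ae_bounded[mf _] cg fg; congr fine.
apply: ae_eq_integral => //.
- by apply/measurable_EFinP; exact: measurable_funTS.
- by apply/measurable_EFinP; apply: measurable_funTS; exact: continuous_measurable_fun.
- by apply: ae_sub fg => x /= -> _.
Qed.

Lemma weak_derivn_Linfty0 m (u g : R -> R) : weak_derivn_Linfty m u g -> is_Linfty u.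
Proof. by case: m => [|m] []. Qed.

Lemma weak_derivn_Linfty_last m (u g : R -> R) : weak_derivn_Linfty m u g -> is_Linfty g.
Proof.
elim: m u => [|m IH] u /= []; first by move=> h <-.
by move=> _ [v [_ /IH]].
Qed.

(* [V] is the continuous representative of [v], and [T] its Taylor polynomial
   of degree [m] at [c]. *)
Lemma weak_taylor (a b M : R) m (v g : R -> R) : 0 <= M ->
  weak_derivn_Linfty m.+1 v g ->
  (\forall x \ae mu, `[a, b]%classic x -> `|g x| <= M) ->
  exists V V1 : R -> R,
  [/\ \forall x \ae mu, v x = V x, continuous V,
      (0 < m)%N -> forall x : R, is_derive x 1 V (V1 x) &
      forall c, a <= c -> exists2 T : {poly R}, (size T <= m.+1)%N &
        forall x, c <= x <= b -> `|V x - T.[x]| <= M * (x - c) ^+ m.+1 /\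
          ((0 < m)%N -> `|V1 x - T^`().[x]| <= M * (x - c) ^+ m)].
Proof.
move=> M0; elim: m v => [|m IH] v.
  case=> vL [w [vw [wL wg]]] gM; subst w.
  have [V [vV Vinc]] := weak_deriv_primitive vL wL vw.
  (* In the base case [V] is only Lipschitz; the clauses about its derivative are guarded by
     [0 < m]. *)
  exists V, V; split => //.
    have [_ [M' M'0 gM']] := Linfty_ae_bounded wL.
    apply: (increment_continuous M'0) => s t st; rewrite Vinc//.
    by apply: (@Rintegral_le_ae g s t M') => //; apply: ae_sub gM'.
  move=> c ac; exists (V c)%:P; first by rewrite size_polyC leq_b1.
  move=> x /andP[cx xb]; split => //; rewrite hornerC Vinc// expr1.
  exact: (@Rintegral_le_ae g a b).
case=> vL [w [vw wD]] gM.
have wL := @weak_derivn_Linfty0 m.+1 w g wD.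
have [W [W1 [wW cW _ WT]]] := IH w wD gM.
have [V [vV Vinc]] := weak_deriv_primitive vL wL vw.
have VW := increment_is_derive cW (fun s t st => etrans (Vinc s t st) (ae_eq_Rintegral_itv s t wL cW wW)).
exists V, W; split => //.
  move=> x; apply/differentiable_continuous/derivable1_diffP.
  by have [] := VW x.
move=> c ac; have [T1 sT1 T1W] := WT c ac.
(* The Taylor polynomial of the derivative is integrated and adjusted to agree with [V] at [c]. The
   mean value inequality then gains one power of $x-c$; compared with Taylor's formula it only gives
   up the factorial. *)
pose T := poly_prim T1 + (V c - (poly_prim T1).[c])%:P.
have dT : T^`() = T1 by rewrite derivD derivC addr0 poly_prim_deriv.
exists T.
  rewrite (leq_trans (size_polyD _ _))// geq_max size_polyC.
  by rewrite (leq_trans (size_poly_prim _))//= (leq_trans (leq_b1 _)).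
move=> x /andP[cx xb]; split; last first.
  by move=> _; rewrite dT; apply: (T1W x _).1; rewrite cx.
have Tc : T.[c] = V c by rewrite hornerD hornerC addrC subrK.
have dVT (y : R) : is_derive y 1 (fun z => V z - T.[z]) (W y - T1.[y]).
  by rewrite -dT; apply: is_deriveB.
have := @mean_value_le _ _ c x (M * (x - c) ^+ m.+1) cx dVT.
rewrite Tc subrr subr0 -mulrA -exprSr; apply => y /andP[cy yx].
apply: (le_trans (T1W y _).1); first by rewrite cy (le_trans yx).
by rewrite ler_wpM2l// lerXn2r ?nnegrE ?subr_ge0// ?(le_trans cy yx)// lerD2r.
Qed.

End WeakTaylor.

(** * Scaling to a cell and the local projection *)

Section LocalProjection.
Variable R : realType.
Local Notation mu := (@lebesgue_measure R).

Definition affp (c h : R) (p : {poly R}) : {poly R} := p \Po (c%:P + h *: 'X).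

Lemma horner_affp c h p t : (affp c h p).[t] = p.[c + h * t].
Proof. by rewrite horner_comp hornerD hornerC hornerZ hornerX. Qed.

Lemma deriv_affp c h p : (affp c h p)^`() = h *: affp c h p^`().
Proof.
by rewrite /affp deriv_comp derivD derivC derivZ derivX add0r alg_polyC mulrC mul_polyC.
Qed.

Lemma affpM c h p q : affp c h (p * q) = affp c h p * affp c h q.
Proof. exact: comp_polyM. Qed.

Lemma size_affp c h p : h != 0 -> size (affp c h p) = size p.
Proof.
move=> h0; rewrite size_comp_poly2//.
by rewrite addrC size_polyDl ?size_scale ?size_polyX// size_polyC; case: (c != 0).
Qed.

Lemma integrable_itvoo (f : R -> R) (c d : R) : continuous f ->
  mu.-integrable `]c, d[ (EFin \o f).
Proof.
move=> cf; have icc : mu.-integrable `[c, d] (EFin \o f).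
  apply: continuous_compact_integrable; first exact: segment_compact.
  exact: continuous_subspaceT.
by apply: integrableS icc => //; exact: subset_itv_oo_cc.
Qed.

Lemma Rintegral_itvoo_poly (c d : R) (p : {poly R}) : c < d ->
  \int[mu]_(x in `]c, d[) p.[x] = (d - c) * unit_int (affp c (d - c) p).
Proof.
move=> cd; have cp := @continuous_horner R p.
have icc : mu.-integrable `[c, d] (EFin \o horner p).
  apply: continuous_compact_integrable; first exact: segment_compact.
  exact: continuous_subspaceT.
have ioc : mu.-integrable `]c, d] (EFin \o horner p).
  by apply: integrableS icc => //; apply: subset_itvr; rewrite bnd_simp.
rewrite Rintegral_itv_bndo_bndc; last exact: integrable_itvoo.
rewrite Rintegral_itv_obnd_cbnd// /Rintegral.
have dP x := is_derive_poly (poly_prim p) x.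
rewrite (@continuous_FTC2 _ _ (horner (poly_prim p)))//.
- have := deriv_affp c (d - c) (poly_prim p); rewrite poly_prim_deriv /= -unit_intZ => <-.
  rewrite unit_int_deriv !horner_affp.
  by rewrite mulr1 mulr0 addr0 [c + (d - c)]addrC subrK.
- exact: continuous_subspaceT.
- have C := @continuous_horner R (poly_prim p).
  by split; [move=> x _ | exact/cvg_at_right_filter/C | exact/cvg_at_left_filter/C].
- by move=> x _; rewrite -derivE poly_prim_deriv.
Qed.

(** These pull back to the monomials on $[0,1]$, so cell moments become those of [local_dof]. *)
Definition cell_monomial (c h : R) (i : nat) : {poly R} :=
  (h^-1 *: ('X - c%:P)) ^+ i.

Lemma affp_cell_monomial c h i : h != 0 -> affp c h (cell_monomial c h i) = 'X^i.
Proof.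
move=> h0; rewrite /affp rmorphXn /= comp_polyZ comp_polyB comp_polyX comp_polyC.
by rewrite [_ + _ *: _]addrC addrK scalerA mulVf// scale1r.
Qed.

Lemma size_cell_monomial c h i : (size (cell_monomial c h i) <= i.+1)%N.
Proof.
rewrite (leq_trans (size_poly_exp_leq _ _))// ltnS.
have : (size (h^-1 *: ('X - c%:P)) <= 2)%N.
  by rewrite (leq_trans (size_scale_leq _ _))// size_XsubC.
by case: size => [|[|[|]]]//= _; rewrite ?mul0n ?mul1n.
Qed.

Lemma Rintegral_cell_monomial (c d : R) (p : {poly R}) i : c < d ->
  \int[mu]_(x in `]c, d[) (p.[x] * (cell_monomial c (d - c) i).[x])
  = (d - c) * unit_int (affp c (d - c) p * 'X^i).
Proof.
move=> cd; have h0 : d - c != 0 by rewrite subr_eq0 gt_eqF.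
rewrite -(affp_cell_monomial c i h0) -affpM -Rintegral_itvoo_poly//.
by apply: eq_Rintegral => x _; rewrite hornerM.
Qed.

(** The projection reproduces polynomials of degree at most [k], so only [u - T] has to be
    projected, and its degrees of freedom are at most [B]. Derivatives carry a factor $d-c$ to be
    homogeneous with values; [q] lives on the unit interval, which keeps [K] independent of the
    cell. *)
Lemma local_projection k : (0 < k)%N -> exists2 K : R, 0 < K &
  forall (u u1 : R -> R) (c d B : R) (T : {poly R}), continuous u -> c < d ->
    (size T <= k.+1)%N ->
    (forall x, c <= x <= d -> `|u x - T.[x]| <= B /\ (d - c) * `|u1 x - T^`().[x]| <= B) ->
    exists q : {poly R},
      [/\ (size q <= k.+1)%N,
          forall i, (i < k.-1)%N ->
            \int[mu]_(x in `]c, d[) (u x * (cell_monomial c (d - c) i).[x]) =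
            (d - c) * unit_int (q * 'X^i),
          q.[1] = u d /\ q^`().[0] = (d - c) * u1 c,
          forall x, c <= x <= d -> `|u x - q.[(x - c) / (d - c)]| <= K * B &
          `|(d - c) * u1 d - q^`().[1]| <= K * B].
Proof.
move=> k0; have [K K0 HK] := horner_le_local_dof R k0.
exists (1 + K); first by rewrite addr_gt0.
move=> u u1 c d B T cu cd sT uT; set h := d - c.
have hp : 0 < h by rewrite subr_gt0.
have h0 : h != 0 by rewrite gt_eqF.
have Eh : c + h = d by rewrite addrC subrK.
have cc : c <= c <= d by rewrite lexx ltW.
have dd : c <= d <= d by rewrite lexx ltW.
have B0 : 0 <= B := le_trans (normr_ge0 _) (uT c cc).1.
pose mom i := \int[mu]_(x in `]c, d[) ((u x - T.[x]) * (cell_monomial c h i).[x]).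
(* These are the degrees of freedom of [u - T] after pulling back: an integral is divided by [h], a
   derivative multiplied by it. *)
pose dof j := if (j < k.-1)%N then h^-1 * mom j
  else if j == k.-1 then u d - T.[d] else h * (u1 c - T^`().[c]).
have [r sr rd] := local_dof_surj dof k0.
have dofB j : (j < k.+1)%N -> `|local_dof k r j| <= B.
  move=> jk; rewrite rd// /dof; case: ifP => _; last first.
    case: ifP => _; first exact: (uT d dd).1.
    by rewrite normrM gtr0_norm//; exact: (uT c cc).2.
  rewrite normrM gtr0_norm ?invr_gt0// ler_pdivrMl//.
  have -> : h * B = B * fine (mu `]c, d[%classic).
    by rewrite lebesgue_measure_itv /= lte_fin cd /= mulrC.
  apply: ae_bounded_Rintegral => //.
  - by rewrite lebesgue_measure_itv /= lte_fin cd -EFinB ltry.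
  - apply: measurable_funTS; apply: continuous_measurable_fun => x.
    apply: cvgM; last exact: continuous_horner.
    by apply: cvgB; [exact: cu | exact: continuous_horner].
  - apply: ae_all => x /=; rewrite in_itv /= => /andP[cx xd].
    rewrite normrM -[B]mulr1 ler_pM//; first by apply: (uT x _).1; rewrite !ltW.
    rewrite horner_exp hornerZ hornerXsubC normrX exprn_ile1//.
    rewrite ger0_norm ?mulr_ge0 ?invr_ge0 ?subr_ge0 ?ltW//.
    by rewrite ltr_pdivrMl// mulr1 ltrD2r.
have rB := HK r B sr dofB.
exists (affp c h T + r); split.
- by rewrite (leq_trans (size_polyD _ _))// geq_max size_affp// sT.
- move=> i ik; rewrite [(_ + r) * _]mulrDl unit_intD mulrDr -Rintegral_cell_monomial//.
  have := rd i _; rewrite /local_dof /dof ik => ->; last first.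
    by rewrite (ltn_trans ik)// ltnS leq_pred.
  rewrite mulrA divff// mul1r /mom -RintegralD//.
  + apply: eq_Rintegral => x _; rewrite -/h; ring.
  + apply: integrable_itvoo => x; apply: cvgM; exact: continuous_horner.
  + apply: integrable_itvoo => x; apply: cvgM; last exact: continuous_horner.
    by apply: cvgB; [exact: cu | exact: continuous_horner].
- have r1 : r.[1] = u d - T.[d].
    by have := rd k.-1; rewrite /local_dof /dof ltnn eqxx => -> //; rewrite ltnS leq_pred.
  have r0 : r^`().[0] = h * (u1 c - T^`().[c]).
    by have := rd k (leqnn _); rewrite /local_dof /dof ltnNge leq_pred /= gtn_eqF ?prednK.
  rewrite derivD !hornerD deriv_affp hornerZ !horner_affp mulr1 mulr0 addr0 Eh r1 r0.
  by split; ring.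
- move=> x /andP[cx xd].
  have x01 : 0 <= (x - c) / h <= 1.
    apply/andP; split; first by rewrite divr_ge0 ?subr_ge0// ltW.
    by rewrite ler_pdivrMr// mul1r lerD2r.
  have xE : c + h * ((x - c) / h) = x by rewrite mulrC divfK// addrC subrK.
  rewrite hornerD horner_affp xE opprD addrA (le_trans (ler_normB _ _))//.
  by rewrite [(1 + K) * B]mulrDl mul1r lerD// ?(rB _ x01).1//; apply: (uT x _).1; rewrite cx.
- rewrite derivD hornerD deriv_affp hornerZ horner_affp mulr1 Eh.
  have := (rB 1 _).2; rewrite lexx ler01 => /(_ isT) r1.
  have u1d := (uT d dd).2.
  rewrite opprD addrA -mulrBr (le_trans (ler_normB _ _))// [(1 + K) * B]mulrDl mul1r lerD//.
  by rewrite normrM gtr0_norm.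
Qed.

End LocalProjection.

(** * The interface recurrence *)

Section ComplexModulus.
Variable R : realType.
Implicit Types z w : R[i].

Lemma cmodE z : `|z| = (cmod z)%:C%C.
Proof.
by case: z => x y; rewrite /cmod normc_def.
Qed.

Lemma cmod_ge0 z : 0 <= cmod z.
Proof. by rewrite -(@lecR R) -cmodE rmorph0 normr_ge0. Qed.

Lemma cmodM z w : cmod (z * w) = cmod z * cmod w.
Proof. by apply: (@complexI R); rewrite -cmodE normrM !cmodE rmorphM. Qed.

Lemma cmodD_le z w : cmod (z + w) <= cmod z + cmod w.
Proof. by rewrite -(@lecR R) rmorphD /= -!cmodE ler_normD. Qed.

Lemma cmod0 : cmod (0 : R[i]) = 0.
Proof. by rewrite /cmod normr0. Qed.

Lemma cmod_eq0 z : cmod z = 0 -> z = 0.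
Proof. by move=> z0; apply/normr0_eq0; rewrite cmodE z0. Qed.

Lemma cmod1 : cmod (1 : R[i]) = 1.
Proof. by rewrite /cmod normr1. Qed.

Lemma cmodX z n : cmod (z ^+ n) = cmod z ^+ n.
Proof.
elim: n => [|n IH]; first by rewrite !expr0 cmod1.
by rewrite !exprS cmodM IH.
Qed.

Lemma cmod_sqr z : cmod z ^+ 2 = complex.Re z ^+ 2 + complex.Im z ^+ 2.
Proof.
by case: z => x y; rewrite /cmod normc_def /= sqr_sqrtr// addr_ge0 ?sqr_ge0.
Qed.

Lemma cmod_real (x : R) : cmod x%:C%C = `|x|.
Proof.
by apply/eqP; rewrite -(@eqrXn2 _ 2) ?cmod_ge0 ?normr_ge0// cmod_sqr /= expr0n addr0 real_normK ?num_real.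
Qed.

Lemma Re_le_cmod z : `|complex.Re z| <= cmod z.
Proof.
rewrite -ler_sqr ?nnegrE ?normr_ge0 ?cmod_ge0//.
by rewrite cmod_sqr real_normK ?num_real// lerDl sqr_ge0.
Qed.

End ComplexModulus.

(** * Max norms and a cyclic recurrence *)

Section MaxNorm.
Variables (R : realType) (n : nat).
Implicit Types v w : 'cV[R[i]]_n.

Lemma vnorm_oo_ge v i : cmod (v i 0) <= vnorm_oo v.
Proof. exact: le_bigmax. Qed.

Lemma vnorm_oo_le v (B : R) : 0 <= B -> (forall i, cmod (v i 0) <= B) -> vnorm_oo v <= B.
Proof. by move=> B0 vB; apply: bigmax_le. Qed.

Lemma vnorm_oo_ge0 v : 0 <= vnorm_oo v.
Proof. exact: bigmax_ge_id. Qed.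

Lemma vnorm_ooD v w : vnorm_oo (v + w) <= vnorm_oo v + vnorm_oo w.
Proof.
apply: vnorm_oo_le => [|i]; first by rewrite addr_ge0// vnorm_oo_ge0.
by rewrite mxE (le_trans (cmodD_le _ _))// lerD// vnorm_oo_ge.
Qed.

Lemma vnorm_ooZ (c : R[i]) v : vnorm_oo (c *: v) = cmod c * vnorm_oo v.
Proof.
apply/le_anti/andP; split.
  apply: vnorm_oo_le => [|i]; first by rewrite mulr_ge0 ?cmod_ge0 ?vnorm_oo_ge0.
  by rewrite mxE cmodM ler_wpM2l ?cmod_ge0// vnorm_oo_ge.
have [c0|c0] := eqVneq (cmod c) 0; first by rewrite c0 mul0r vnorm_oo_ge0.
have cp : 0 < cmod c by rewrite lt_neqAle eq_sym c0 cmod_ge0.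
rewrite -ler_pdivlMl//; apply: vnorm_oo_le => [|i].
  by rewrite mulr_ge0 ?invr_ge0 ?(ltW cp)// vnorm_oo_ge0.
rewrite ler_pdivlMl// -cmodM.
by have := vnorm_oo_ge (c *: v) i; rewrite mxE.
Qed.

Lemma vnorm_oo0 : vnorm_oo (0 : 'cV[R[i]]_n) = 0.
Proof. by rewrite -(scale0r 0) vnorm_ooZ cmod0 mul0r. Qed.

Lemma mnorm_oo_ub (A : 'M[R[i]]_n) v : vnorm_oo v <= 1 -> vnorm_oo (A *m v) <= mnorm_oo A.
Proof.
move=> v1; apply: ub_le_sup; last by exists v.
(* [sup] is informative only for a set bounded above; the sum of all entries is a crude but
   sufficient bound. *)
exists (\sum_i \sum_j cmod (A i j)) => _ [x x1 <-].
have S0 i : 0 <= \sum_j cmod (A i j) by rewrite sumr_ge0// => j _; exact: cmod_ge0.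
apply: vnorm_oo_le => [|i]; first by rewrite sumr_ge0.
apply: (@le_trans _ _ (\sum_j cmod (A i j))); last first.
  by rewrite [leRHS](bigD1 i)//= lerDl sumr_ge0.
rewrite mxE; elim/big_ind2 : _ => [|z1 y1 z2 y2 h1 h2|j _]; first by rewrite cmod0.
  by rewrite (le_trans (cmodD_le _ _))// lerD.
rewrite cmodM ler_piMr ?cmod_ge0//.
exact: le_trans (vnorm_oo_ge x j) x1.
Qed.

Lemma mnorm_oo_ge0 (A : 'M[R[i]]_n) : 0 <= mnorm_oo A.
Proof. by rewrite (le_trans (vnorm_oo_ge0 (A *m 0)))// mnorm_oo_ub// vnorm_oo0 ler01. Qed.

Lemma mnorm_oo_mul (A : 'M[R[i]]_n) v : vnorm_oo (A *m v) <= mnorm_oo A * vnorm_oo v.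
Proof.
have [v0|v0] := eqVneq (vnorm_oo v) 0.
  have -> : v = 0.
    apply/colP => i; rewrite mxE; apply/cmod_eq0/le_anti.
    by rewrite cmod_ge0 -{1}v0 vnorm_oo_ge.
  by rewrite mulmx0 vnorm_oo0 mulr0.
have vp : 0 < vnorm_oo v by rewrite lt_neqAle eq_sym v0 vnorm_oo_ge0.
have := @mnorm_oo_ub A ((vnorm_oo v)^-1%:C%C *: v).
rewrite -scalemxAr !vnorm_ooZ cmod_real ger0_norm ?invr_ge0 ?(ltW vp)// mulVf//.
by rewrite lexx => /(_ isT); rewrite ler_pdivrMl// mulrC.
Qed.

(* Unrolling [n] steps around the cycle gives [(1 - l ^+ n) Y i] as a sum of
   [n] terms. *)
Lemma cyclic_recurrence_le (l : R[i]) (N : nat) (Y : nat -> 'cV[R[i]]_n) (D : R) :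
  cmod l = 1 -> (forall i, vnorm_oo (Y i - l *: Y i.+1) <= D) ->
  (forall i, Y (i + N)%N = Y i) ->
  forall i, cmod (1 - l ^+ N) * vnorm_oo (Y i) <= N%:R * D.
Proof.
move=> l1 YD per i.
have H m : vnorm_oo (Y i - l ^+ m *: Y (i + m)%N) <= m%:R * D.
  elim: m => [|m IH]; first by rewrite expr0 scale1r addn0 subrr vnorm_oo0 mul0r.
  have -> : Y i - l ^+ m.+1 *: Y (i + m.+1)%N =
      (Y i - l ^+ m *: Y (i + m)%N) + l ^+ m *: (Y (i + m)%N - l *: Y (i + m).+1).
    by rewrite scalerBr scalerA -exprSr addnS addrA subrK.
  rewrite (le_trans (vnorm_ooD _ _))// -[in leRHS]natr1 mulrDl mul1r lerD//.
  by rewrite vnorm_ooZ cmodX l1 expr1n mul1r.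
by rewrite -vnorm_ooZ scalerBl scale1r -{2}(per i).
Qed.

End MaxNorm.

(** * The transfer matrix across an interface and its spectrum *)

Section JumpRecurrence.
Variables (R : realType) (k : nat) (h al be1 be2 : R).
Hypotheses (h0 : h != 0) (k0 : (0 < k)%N).

Local Notation G := (Gamma k h al be1 be2).
Local Notation L := (Lambda k h al be1 be2).
Local Notation sgn := ((-1) ^+ k.+1 : R).

(** With [hi_step], the rows of the transfer matrix $M=\frac{(-1)^{k+1}}{\Lambda}(\Gamma+A)$, where
    $A$ has rows $(c_2,\,b_1+b_2)$ and $(b_1-b_2,\,-c_2)$. *)
Definition lo_step (lo hi : R) : R :=
  sgn / L * ((G + c2 k h al) * lo + (b1 k h al be1 be2 + b2 k h al be1 be2) * hi).
Definition hi_step (lo hi : R) : R :=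
  sgn / L * ((b1 k h al be1 be2 - b2 k h al be1 be2) * lo + (G - c2 k h al) * hi).

Definition V1_lo : R := L^-1 * (- be1 + k%:R * (k%:R + 1) / h *
  ((1 / 2 - al) ^+ 2 + be1 * be2)).
Definition V1_hi : R := L^-1 * (be1 - k%:R * (k%:R - 1) / h *
  ((1 / 2 - al) ^+ 2 + be1 * be2)).

(* [Em, dEm] and [Ep, dEp] are the traces of the error and of its derivative on
   both sides of an interface; [np, nm] are the two interface values at which
   the local projection differs from [u]. *)
Lemma jump_recurrence (lo hi lo' hi' Em Ep dEm dEp np nm : R) : L != 0 ->
  Em = lo + hi -> Ep = sgn * (lo' - hi') ->
  dEm = (k%:R * (k%:R - 1) * lo + k%:R * (k%:R + 1) * hi) / h ->
  dEp = sgn * (- (k%:R * (k%:R - 1)) * lo' + k%:R * (k%:R + 1) * hi') / h ->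
  (Ep + Em) / 2 - al * (Ep - Em) + be2 * (dEp - dEm)
    = (1 / 2 - al) * np - be2 * nm ->
  (dEp + dEm) / 2 + al * (dEp - dEm) + be1 * (Ep - Em)
    = (1 / 2 - al) * nm + be1 * np ->
  lo = lo_step lo' hi' + np * V1_lo + nm * - (h / (2 * k%:R)) /\
  hi = hi_step lo' hi' + np * V1_hi + nm * (h / (2 * k%:R)).
Proof.
move=> L0 -> -> -> -> /eqP + /eqP.
rewrite -subr_eq0 => /eqP; set A := (X in X = 0 -> _) => A0.
rewrite -subr_eq0 => /eqP; set B := (X in X = 0 -> _) => B0.
have kn0 : k%:R != 0 :> R by rewrite pnatr_eq0 -lt0n.
pose d1 := k%:R * (k%:R - 1) / h : R; pose d2 := k%:R * (k%:R + 1) / h : R.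
split; apply: (mulfI L0); apply/eqP; rewrite -subr_eq0; apply/eqP.
  (* Elimination of [hi] from the two interface equations: the weights are its coefficients in them,
     and [lo] is left with coefficient $\Lambda$. The second half eliminates [lo] in the same way,
     with [d1]. *)
  transitivity (((1 / 2 - al) * d2 - be1) * A - (1 / 2 + al - be2 * d2) * B).
    rewrite /A /B /d1 /d2 /lo_step /V1_lo !mulrDr ![L * (_ * (L^-1 * _))]mulrCA.
    rewrite ![L * (L^-1 * _)]mulVKf// ![L * (sgn / L * _)]mulrA ![L * (sgn / L)]mulrC !divfK//.
    by rewrite /Gamma /Lambda /c2 /b1 /b2; field; rewrite h0 kn0.
  by rewrite A0 B0 !mulr0 subrr.
transitivity (- ((1 / 2 - al) * d1 - be1) * A + (1 / 2 + al - be2 * d1) * B).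
  rewrite /A /B /d1 /d2 /hi_step /V1_hi !mulrDr ![L * (_ * (L^-1 * _))]mulrCA.
  rewrite ![L * (L^-1 * _)]mulVKf// ![L * (sgn / L * _)]mulrA ![L * (sgn / L)]mulrC !divfK//.
  by rewrite /Gamma /Lambda /c2 /b1 /b2; field; rewrite h0 kn0.
by rewrite A0 B0 !mulr0 addr0.
Qed.

Definition ccol (lo hi : R) : 'cV[R[i]]_2 := \col_(i < 2) ([:: lo; hi]`_i)%:C%C.

Hypothesis GL : `|G| < `|L|.

Local Notation s := (sqrtGL k h al be1 be2).

Lemma GL_sqr : G ^+ 2 < L ^+ 2.
Proof. by rewrite -(real_normK (num_real G)) -(real_normK (num_real L)) ltr_sqr ?nnegrE. Qed.

Lemma sqrtGL_neq0 : s != 0.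
Proof.
rewrite /sqrtGL eq_complex /= eqxx /= gt_eqF// sqrtr_gt0 subr_gt0.
exact: GL_sqr.
Qed.

Lemma sqrtGL_sqr : s ^+ 2 = (G ^+ 2 - L ^+ 2)%:C%C.
Proof.
rewrite /sqrtGL expr2; apply/eqP; rewrite eq_complex /= !mul0r mulr0 addr0 eqxx andbT.
by rewrite sub0r -expr2 sqr_sqrtr ?opprB// subr_ge0 ltW// GL_sqr.
Qed.

(** As $A$ has trace zero, this says $A^2=\Gamma^2-\Lambda^2$ by Cayley-Hamilton. *)
Lemma bc_sqr : c2 k h al ^+ 2 + (b1 k h al be1 be2 + b2 k h al be1 be2)
   * (b1 k h al be1 be2 - b2 k h al be1 be2) = G ^+ 2 - L ^+ 2.
Proof. by rewrite /Gamma /Lambda /c2 /b1 /b2; field. Qed.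

Lemma Lambda_neq0 : L != 0.
Proof. by rewrite -normr_gt0 (le_lt_trans _ GL). Qed.

Lemma cmod_lambda1 : cmod (lambda1 k h al be1 be2) = 1.
Proof.
apply/eqP; rewrite -(@eqrXn2 _ 2) ?cmod_ge0// cmodM expr1n exprMn cmod_real.
rewrite cmod_sqr /= addr0 add0r sqr_sqrtr ?subr_ge0 ?(ltW GL_sqr)//.
rewrite addrC subrK real_normK ?num_real// exprMn sqrr_sign mul1r exprVn.
by rewrite mulVf// expf_neq0// Lambda_neq0.
Qed.

Lemma Q1_mul_ccol (lo hi : R) (i : 'I_2) :
  (Q1 k h al be1 be2 *m ccol lo hi) i 0 =
  (2 * s)^-1 * ((if i == 0 then c2 k h al * lo + (b1 k h al be1 be2 + b2 k h al be1 be2) * hi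
    else (b1 k h al be1 be2 - b2 k h al be1 be2) * lo - c2 k h al * hi)%:C%C
   + s * (if i == 0 then lo else hi)%:C%C).
Proof.
rewrite /Q1 -scalemxAl !mxE; congr (_ * _).
rewrite !big_ord_recl big_ord0 addr0 !mxE /=.
move: (c2 k h al) (b1 k h al be1 be2) (b2 k h al be1 be2) s => c p q t.
by case: i => -[|[|]]//= _; rewrite !(rmorphD, rmorphB, rmorphM) /=; ring.
Qed.

(** With $s$ standing for [sqrtGL], $A^2=s^2$ gives $(A+s)A=s(A+s)$, and $2sQ_1=A+s$. *)
Lemma Q1_step (lo hi : R) :
  Q1 k h al be1 be2 *m ccol (lo_step lo hi) (hi_step lo hi) =
  lambda1 k h al be1 be2 *: (Q1 k h al be1 be2 *m ccol lo hi).
Proof.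
apply/colP => i; rewrite [RHS]mxE !Q1_mul_ccol [RHS]mulrCA; congr (_ * _).
have s2 := sqrtGL_sqr; rewrite -bc_sqr in s2.
rewrite /lo_step /hi_step /lambda1.
move: s2; move: (sgn / L) (c2 k h al) (b1 k h al be1 be2) (b2 k h al be1 be2) G s.
move=> r c p q g t /eqP; rewrite -subr_eq0 => /eqP t2.
apply/eqP; rewrite -subr_eq0; apply/eqP.
(* The two sides differ by a multiple of $s^2-A^2$, in scalar form. *)
transitivity (- (r * (if i == 0 then lo else hi))%:C%C * (t ^+ 2 - (c ^+ 2 + (p + q) * (p - q))%:C%C)).
  case: i => -[|[|]]//= _.
    by rewrite !(rmorphD, rmorphB, rmorphM, rmorphXn) /=; ring.
  by rewrite !(rmorphD, rmorphB, rmorphM, rmorphXn) /=; ring.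
by rewrite t2 mulr0.
Qed.

Lemma Re_Q1_ccol (lo hi : R) (i : 'I_2) :
  complex.Re ((Q1 k h al be1 be2 *m ccol lo hi) i 0) = (if i == 0 then lo else hi) / 2.
Proof.
rewrite Q1_mul_ccol mulrDr.
have -> (x : R[i]) : (2 * s)^-1 * (s * x) = 2^-1 * x.
  by field; rewrite sqrtGL_neq0.
have -> (x y : R) : complex.Re ((2 * s)^-1 * x%:C%C + 2^-1 * y%:C%C) = y / 2.
  have -> : (2 * s)^-1 = (0 +i* - (2 * Num.sqrt (L ^+ 2 - G ^+ 2))^-1)%C.
    apply: (@mulfI _ (2 * s)); first by rewrite mulf_neq0 ?sqrtGL_neq0 ?pnatr_eq0.
    rewrite mulfV ?mulf_neq0 ?sqrtGL_neq0 ?pnatr_eq0//.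
    have r0 : Num.sqrt (L ^+ 2 - G ^+ 2) != 0.
      by rewrite gt_eqF// sqrtr_gt0 subr_gt0 GL_sqr.
    rewrite /sqrtGL; apply/eqP; rewrite eq_complex /=; apply/andP; split; apply/eqP; field;
      exact: r0.
  have -> : 2^-1 * y%:C%C = (y / 2)%:C%C by rewrite mulrC rmorphM fmorphV rmorph_nat.
  by rewrite /= mul0r mulr0 subrr add0r.
by [].
Qed.

Lemma lo_hi_le_Q1 (lo hi : R) :
  `|lo| <= 2 * vnorm_oo (Q1 k h al be1 be2 *m ccol lo hi) /\
  `|hi| <= 2 * vnorm_oo (Q1 k h al be1 be2 *m ccol lo hi).
Proof.
split.
  have := le_trans (Re_le_cmod _) (vnorm_oo_ge (Q1 k h al be1 be2 *m ccol lo hi) 0).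
  by rewrite Re_Q1_ccol /= normrM (@gtr0_norm _ 2^-1) ?invr_gt0// ler_pdivrMr// mulrC.
have := le_trans (Re_le_cmod _) (vnorm_oo_ge (Q1 k h al be1 be2 *m ccol lo hi) 1).
by rewrite Re_Q1_ccol /= normrM (@gtr0_norm _ 2^-1) ?invr_gt0// ler_pdivrMr// mulrC.
Qed.

End JumpRecurrence.

(** * The global error *)

Section Mesh.
Variables (R : realType) (a b : R) (N : nat).
Hypotheses (ab : a < b) (N0 : (0 < N)%N).
Local Notation h := (mesh_size a b N).

Lemma mesh_size_gt0 : 0 < h.
Proof. by rewrite divr_gt0 ?subr_gt0// ltr0n. Qed.

Lemma mesh_size_mul : N%:R * h = b - a.
Proof. by rewrite mulrC divfK// pnatr_eq0 -lt0n. Qed.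

Lemma nodeS j : node a b N j.+1 = node a b N j + h.
Proof. by rewrite /node -natr1 mulrDl mul1r addrA. Qed.

Lemma node_ltS j : node a b N j < node a b N j.+1.
Proof. by rewrite nodeS ltrDl mesh_size_gt0. Qed.

Lemma node_subr j : node a b N j.+1 - node a b N j = h.
Proof. by rewrite nodeS addrAC subrr add0r. Qed.

Lemma nodeN : node a b N N = b.
Proof. by rewrite /node mesh_size_mul addrC subrK. Qed.

Lemma node_ge j : a <= node a b N j.
Proof. by rewrite lerDl mulr_ge0// ltW// mesh_size_gt0. Qed.

Lemma node_le j : (j <= N)%N -> node a b N j <= b.
Proof. by move=> jN; rewrite -[leRHS]nodeN lerD2l ler_pM2r ?mesh_size_gt0// ler_nat. Qed.

Lemma periodic_node (f : R -> R) j : periodic f (b - a) -> (j < N)%N ->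
  f (node a b N (j.+1 %% N)) = f (node a b N j.+1).
Proof.
move=> per; rewrite leq_eqVlt => /predU1P[jN|jN]; last by rewrite modn_small.
by rewrite jN modnn nodeN -[in RHS](subrK a b) addrC per /node mul0r addr0.
Qed.

Lemma cell_cover x : a <= x <= b ->
  exists2 j, (j < N)%N & node a b N j <= x <= node a b N j.+1.
Proof.
move=> /andP[ax xb].
have [j jN xj] : exists2 j, (j < N)%N & x <= node a b N j.+1.
  by exists N.-1; [rewrite prednK | rewrite prednK// nodeN].
elim: j jN xj => [|j IH] jN xj.
  by exists 0%N => //; rewrite xj andbT /node mul0r addr0.
have [xj'|/ltW xj'] := leP x (node a b N j.+1); first exact: IH (ltnW jN) xj'.
by exists j.+1; rewrite // xj' xj.
Qed.

End Mesh.

(** * One-sided limits of piecewise polynomials *)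

Section Traces.
Variable R : realType.
Implicit Types (f : R -> R) (p : {poly R}).

Lemma lim_at_left_poly f p (c d : R) : c < d ->
  (forall x, `]c, d[%classic x -> f x = p.[x]) -> lim (f x @[x --> d^'-]) = p.[d].
Proof.
move=> cd fp; apply/cvg_lim => //.
have : p.[x] @[x --> d^'-] --> p.[d] by apply/cvg_at_left_filter/continuous_horner.
apply: cvg_trans; apply: near_eq_cvg; near=> x.
by rewrite fp//= in_itv /=; apply/andP; split; near: x;
  [exact: nbhs_left_gt | exact: nbhs_left_lt].
Unshelve. all: by end_near. Qed.

Lemma lim_at_right_poly f p (c d : R) : c < d ->
  (forall x, `]c, d[%classic x -> f x = p.[x]) -> lim (f x @[x --> c^'+]) = p.[c].
Proof.
move=> cd fp; apply/cvg_lim => //.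
have : p.[x] @[x --> c^'+] --> p.[c] by apply/cvg_at_right_filter/continuous_horner.
apply: cvg_trans; apply: near_eq_cvg; near=> x.
by rewrite fp//= in_itv /=; apply/andP; split; near: x;
  [exact: nbhs_right_gt | exact: nbhs_right_lt].
Unshelve. all: by end_near. Qed.

Lemma derive1_itvoo_poly f p (c d : R) :
  (forall x, `]c, d[%classic x -> f x = p.[x]) ->
  forall x, `]c, d[%classic x -> derive1 f x = p^`().[x].
Proof.
move=> fp x xcd; have fpx : \forall y \near x, horner p y = f y.
  have : \forall y \near x, y \in `]c, d[ by exact: near_in_itvoo.
  by apply: filterS => y ycd; rewrite fp.
rewrite derive1E; have [_ ->//] := near_eq_is_derive fpx (is_derive_poly p x).
Qed.

End Traces.

(** * The error recurrence around the periodic mesh *)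

Section GlobalError.
Variables (R : realType) (k : nat).
Hypothesis k0 : (0 < k)%N.
Local Notation mu := (@lebesgue_measure R).

(** The pointwise estimate with $N/|1-\lambda_1^N|$ still explicit; [K] depends on [k] only. *)
Lemma Pstar_cell_error : exists2 K : R, 0 < K &
  forall (a b : R) (N : nat) (al be1 be2 M : R) (u u1 w : R -> R),
    let h := mesh_size a b N in
    let lam := lambda1 k h al be1 be2 in
    a < b -> (0 < N)%N ->
    `|Gamma k h al be1 be2| < `|Lambda k h al be1 be2| ->
    lam ^+ N != 1 ->
    periodic u (b - a) -> continuous u ->
    (forall x : R, is_derive x 1 u (u1 x)) -> 0 <= M ->
    (forall c, a <= c -> exists2 T : {poly R}, (size T <= k.+1)%N &
      forall x, c <= x <= b -> `|u x - T.[x]| <= M * (x - c) ^+ k.+1 /\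
        `|u1 x - T^`().[x]| <= M * (x - c) ^+ k) ->
    is_Pstar a b N k al be1 be2 u w ->
    forall j x, (j < N)%N -> cell a b N j x ->
      `|w x - u x| <= K * M * h ^+ k.+1 *
        (1 + N%:R / cmod (1 - lam ^+ N) * mnorm_oo (Q1 k h al be1 be2) *
          (vnorm_oo (V1 k h al be1 be2) + h^-1 * vnorm_oo (V2 k h))).
Proof.
have [K1 K10 HK1] := local_projection R k0.
have [K2 K20 HK2] := legendre_pair_le R k0.
exists (K1 * (1 + 2 * K2)); first by rewrite mulr_gt0// addr_gt0// mulr_gt0.
move=> a b N al be1 be2 M u u1 w h lam ab N0 GL lamN per cu du M0 uT [wV wP].
have hp : 0 < h by exact: mesh_size_gt0.
have h0 : h != 0 by rewrite gt_eqF.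
(* At the last interface the trace of the derivative from the right is taken at the first node. *)
have per1 : periodic u1 (b - a).
  move=> x; have [_ <-] := du x.
  have -> : u = u \o (fun y => y + (b - a)) by apply/funext => y /=; rewrite per.
  have dsh : is_derive x 1 (fun y : R => y + (b - a)) 1.
    by have := is_deriveD (is_derive_id x 1) (is_derive_cst (b - a) x 1); rewrite addr0.
  have [_ ->] := @is_derive1_comp _ u (fun y => y + (b - a)) x _ _ (du (x + (b - a))) dsh.
  by rewrite mulr1.
pose nd := node a b N.
pose B := M * h ^+ k.+1.
have B0 : 0 <= B by rewrite mulr_ge0// exprn_ge0// ltW.
pose qP j (q : {poly R}) := [/\ (size q <= k.+1)%N,
    forall i, (i < k.-1)%N ->
      \int[mu]_(x in `]nd j, nd j.+1[) (u x * (cell_monomial (nd j) h i).[x]) =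
            h * unit_int (q * 'X^i),
    q.[1] = u (nd j.+1) /\ q^`().[0] = h * u1 (nd j),
    forall x, nd j <= x <= nd j.+1 -> `|u x - q.[(x - nd j) / h]| <= K1 * B &
    `|h * u1 (nd j.+1) - q^`().[1]| <= K1 * B].
have /choice[q qj] : forall j, exists q, (j < N)%N -> qP j q.
  move=> j; have [jN|jN] := ltnP j N; last by exists 0.
  have [T sT TP] := uT (nd j) (node_ge ab N0 j).
  have jj := node_ltS ab N0 j.
  have [|q Hq] := HK1 u u1 (nd j) (nd j.+1) B T cu jj sT.
    move=> x /andP[jx xj]; have xb := le_trans xj (node_le ab N0 jN).
    rewrite node_subr -/h; have xh : x - nd j <= h by rewrite /h -(node_subr a b N j) lerD2r.
    have xh0 : 0 <= x - nd j by rewrite subr_ge0.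
    have [] := TP x; first by rewrite jx xb.
    move=> T1 T2; split.
      by rewrite (le_trans T1)// ler_wpM2l// lerXn2r// nnegrE ltW.
    rewrite /B exprS mulrCA ler_pM2l// (le_trans T2)// ler_wpM2l// lerXn2r// nnegrE ltW//.
  by exists q => _; move: Hq; rewrite node_subr.
have /choice[P Pj] : forall j, exists p : {poly R}, (j < N)%N ->
    (size p <= k.+1)%N /\ forall x, cell a b N j x -> w x = p.[x].
  move=> j; have [jN|jN] := ltnP j N; last by exists 0.
  by have [p Hp] := wV j jN; exists p.
(* The error $w-q$ on cell [j], pulled back to the unit interval. *)
pose E j := affp (nd j) h (P j) - q j.
have affP j : affp (nd j) h (P j) = E j + q j by rewrite /E subrK.
have HE j : (j < N)%N -> legendre_pair k (E j).
  move=> jN; have [sP wPj] := Pj j jN; have [sq mq _ _ _] := qj j jN.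
  apply: local_dof_legendre_pair.
    by rewrite (leq_trans (size_polyD _ _))// geq_max size_polyN sq size_affp// sP.
  move=> i ik; rewrite local_dofB /local_dof ik; apply/eqP; rewrite subr_eq0; apply/eqP.
  apply: (mulfI h0); rewrite -mq//.
  have [mom _ _] := wP j jN.
  have := mom (cell_monomial (nd j) h i) (leq_trans (size_cell_monomial _ _ _) ik).
  move=> <-; have := @Rintegral_cell_monomial R (nd j) (nd j.+1) (P j) i (node_ltS ab N0 j).
  rewrite node_subr -/h => <-.
  by apply: eq_Rintegral => x /set_mem xj; rewrite wPj.
pose lo j := leg_lo k (E j); pose hi j := leg_hi k (E j).
(* [np] and [nm] are the sources $(u-q)^+$ at the left end and $(u-q)_x^-$ at the right end of cell
   [j]. *)
pose np j := u (nd j) - (q j).[0].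
pose nm j := u1 (nd j.+1) - (q j)^`().[1] / h.
have npB j : (j < N)%N -> `|np j| <= K1 * B.
  move=> jN; have [_ _ _ qu _] := qj j jN; rewrite /np.
  have := qu (nd j); rewrite subrr mul0r; apply.
  by rewrite lexx ltW// node_ltS.
have nmB j : (j < N)%N -> `|nm j| <= K1 * B / h.
  move=> jN; have [_ _ _ _ qu] := qj j jN.
  rewrite ler_pdivlMr// -[in leLHS](gtr0_norm hp) -normrM /nm mulrBl divfK//.
  by rewrite mulrC.
have rec j : (j < N)%N -> let jn := (j.+1 %% N)%N in
    lo j = lo_step k h al be1 be2 (lo jn) (hi jn) + np jn * V1_lo k h al be1 be2
      + nm j * - (h / (2 * k%:R)) /\
    hi j = hi_step k h al be1 be2 (lo jn) (hi jn) + np jn * V1_hi k h al be1 be2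
      + nm j * (h / (2 * k%:R)).
  move=> jN jn; have jnN : (jn < N)%N by rewrite ltn_mod.
  have [_ qj1 [q1 _] _ _] := qj j jN; have [_ _ [_ q0] _ _] := qj jn jnN.
  have [sP wPj] := Pj j jN; have [sPn wPn] := Pj jn jnN.
  have [d1 _] := legendre_pair_deriv k0 (HE j jN).
  have [_ d0] := legendre_pair_deriv k0 (HE jn jnN).
  have [_] := wP j jN.
  have ju : derive1 u (nd j.+1) = u1 (nd j.+1).
    by rewrite derive1E; have [_ ->] := du (nd j.+1).
  rewrite /average /jump /trace_plus /trace_minus -/jn ju.
  rewrite (lim_at_left_poly (node_ltS ab N0 j) wPj).
  rewrite (lim_at_right_poly (node_ltS ab N0 jn) wPn).
  rewrite (lim_at_left_poly (node_ltS ab N0 j) (derive1_itvoo_poly wPj)).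
  rewrite (lim_at_right_poly (node_ltS ab N0 jn) (derive1_itvoo_poly wPn)).
  have val1 i (p : {poly R}) : p.[nd i.+1] = (affp (nd i) h p).[1].
    by rewrite horner_affp mulr1 /nd nodeS.
  have val0 i (p : {poly R}) : p.[nd i] = (affp (nd i) h p).[0].
    by rewrite horner_affp mulr0 addr0.
  have daff i (p : {poly R}) x : (affp (nd i) h p^`()).[x] = (affp (nd i) h p)^`().[x] / h.
    by rewrite deriv_affp hornerZ mulrC mulKf.
  (* [q] matches the value of [u] on the right and its derivative on the left, so only [wp] and
     [dwm] carry a source term. In the interface conditions the data of [u] then cancel. *)
  have wm : (P j).[nd j.+1] = (E j).[1] + u (nd j.+1).
    by rewrite val1 affP hornerD q1.
  have wp : (P jn).[nd jn] = (E jn).[0] + u (nd j.+1) - np jn.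
    rewrite val0 affP hornerD /np /nd (periodic_node N0 per jN); ring.
  have dwm : (P j)^`().[nd j.+1] = (E j)^`().[1] / h + u1 (nd j.+1) - nm j.
    rewrite val1 daff affP derivD hornerD /nm; field; exact: h0.
  have dwp : (P jn)^`().[nd jn] = (E jn)^`().[0] / h + u1 (nd j.+1).
    rewrite val0 daff affP derivD hornerD q0 /nd (periodic_node N0 per1 jN).
    by field; exact: h0.
  rewrite -/(nd _) -/(nd _) wm wp dwm dwp => C1 C2.
  apply: (jump_recurrence h0 k0 (Lambda_neq0 GL) (legendre_pair_horner1 k (E j))
     (legendre_pair_horner0 k (E jn)) (dEm := (E j)^`().[1] / h) (dEp := (E jn)^`().[0] / h)).
  - by rewrite d1.
  - by rewrite d0.
  - move: C1; move: (E jn).[0] (E j).[1] (_ / h) (_ / h) (np jn) (nm j) (u _) => *; lra.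
  - move: C2; move: (E jn).[0] (E j).[1] (_ / h) (_ / h) (np jn) (nm j) (u1 _) => *; lra.
pose Q := Q1 k h al be1 be2.
pose S := mnorm_oo Q * (vnorm_oo (V1 k h al be1 be2) + h^-1 * vnorm_oo (V2 k h)).
(* Indices modulo [N] turn the cyclic recurrence into one over all naturals. *)
pose Y i := Q *m ccol (lo (i %% N)%N) (hi (i %% N)%N).
have YS i : vnorm_oo (Y i - lam *: Y i.+1) <= K1 * B * S.
  have iN : (i %% N < N)%N by rewrite ltn_mod.
  have := rec (i %% N)%N iN.
  have -> : ((i %% N).+1 %% N = i.+1 %% N)%N by rewrite -addn1 modnDml addn1.
  set i1 := (i.+1 %% N)%N => -[Hlo Hhi].
  have i1N : (i1 < N)%N by rewrite ltn_mod.
  have -> : Y i - lam *: Y i.+1 =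
      Q *m ((np i1)%:C%C *: V1 k h al be1 be2 + (nm (i %% N)%N)%:C%C *: V2 k h).
    rewrite /Y -/i1 -[lam *: _](Q1_step h0 GL) -mulmxBr; congr (_ *m _).
    have source (x y1 z1 y2 z2 : R) : (x + y1 * z1 + y2 * z2)%:C%C - x%:C%C =
        y1%:C%C * z1%:C%C + y2%:C%C * z2%:C%C.
      by rewrite !rmorphD !rmorphM /=; ring.
    apply/colP => l; rewrite !mxE /= Hlo Hhi.
    by case: l => -[|[|]]//= _; exact: source.
  rewrite (le_trans (mnorm_oo_mul _ _))// /S mulrCA ler_wpM2l ?mnorm_oo_ge0//.
  rewrite (le_trans (vnorm_ooD _ _))// !vnorm_ooZ !cmod_real mulrDr lerD//.
    by rewrite ler_wpM2r ?vnorm_oo_ge0// npB.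
  by rewrite mulrA ler_wpM2r ?vnorm_oo_ge0// nmB.
have S0 : 0 <= S.
  by rewrite mulr_ge0 ?mnorm_oo_ge0// addr_ge0 ?mulr_ge0 ?vnorm_oo_ge0// invr_ge0 ltW.
have perY i : Y (i + N)%N = Y i by rewrite /Y modnDr.
have YB := cyclic_recurrence_le (cmod_lambda1 GL) YS perY.
have lamp : 0 < cmod (1 - lam ^+ N).
  rewrite lt_neqAle cmod_ge0 andbT eq_sym; apply: contra lamN => /eqP/cmod_eq0/eqP.
  by rewrite subr_eq0 eq_sym.
(* The factor 2 is the one in $e_j=2\,\mathrm{Re}\,Y_j$. *)
pose D := 2 * (N%:R * (K1 * B * S) / cmod (1 - lam ^+ N)).
have loD j : (j < N)%N -> `|lo j| <= D /\ `|hi j| <= D.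
  move=> jN; have [l1 l2] := lo_hi_le_Q1 GL (lo j) (hi j).
  have : vnorm_oo (Y j) <= N%:R * (K1 * B * S) / cmod (1 - lam ^+ N).
    by rewrite ler_pdivlMr// mulrC.
  rewrite /Y modn_small// => YjB.
  by split; [apply: (le_trans l1) | apply: (le_trans l2)]; rewrite /D ler_pM2l.
move=> j x jN xj; have [l1 l2] := loD j jN.
have [_ wPj] := Pj j jN; have [_ _ _ qu _] := qj j jN.
have /andP[jx xj1] : nd j <= x <= nd j.+1.
  by move: xj; rewrite /cell /= in_itv /= => /andP[/ltW -> /ltW ->].
pose t := (x - nd j) / h.
have xE : nd j + h * t = x by rewrite /t mulrC divfK// addrC subrK.
have t01 : 0 <= t <= 1.
  apply/andP; split; first by rewrite divr_ge0 ?subr_ge0// ltW.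
  by rewrite ler_pdivrMr// mul1r /h -(node_subr a b N j) lerD2r.
have := HK2 (E j) D (HE j jN) l1 l2 t t01.
have := qu x; rewrite jx xj1 -/t => /(_ isT).
have -> : w x - u x = (E j).[t] - (u x - (q j).[t]).
  rewrite wPj// -{1}xE -horner_affp affP hornerD; ring.
move=> e1 e2; rewrite (le_trans (ler_normB _ _))// (le_trans (lerD e2 e1))//.
have BM : K1 * (1 + 2 * K2) * M * h ^+ k.+1 = K1 * (1 + 2 * K2) * B by rewrite /B mulrA.
rewrite BM -[_ * mnorm_oo _ * _]mulrA -/S.
have -> : N%:R / cmod (1 - lam ^+ N) * S = N%:R * S / cmod (1 - lam ^+ N).
  by rewrite mulrAC.
have -> : K2 * D = 2 * K2 * K1 * B * (N%:R * S / cmod (1 - lam ^+ N)).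
  by rewrite /D; field; rewrite gt_eqF.
have X0 : 0 <= N%:R * S / cmod (1 - lam ^+ N).
  by apply: divr_ge0; [exact: mulr_ge0 | exact: cmod_ge0].
have Y0 : 0 <= K1 * B by apply: mulr_ge0 => //; exact: ltW.
have Y1 := mulr_ge0 Y0 X0; have Y2 := mulr_ge0 Y0 (ltW K20).
move: X0 Y0 Y1 Y2; move: (N%:R * S / _) => X *; lra.
Qed.

End GlobalError.

(** * From pointwise bounds to norms *)

Section LpBound.
Variable R : realType.
Local Notation mu := (@lebesgue_measure R).

(** The norms are taken over the closed interval, while the estimate holds in open cells; what they
    miss is contained in the countable set of nodes. *)
Lemma ae_itvcc_cells (a b : R) (N : nat) (P : R -> Prop) : a < b -> (0 < N)%N ->
  (forall j x, (j < N)%N -> cell a b N j x -> P x) ->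
  \forall x \ae mu, `[a, b]%classic x -> P x.
Proof.
move=> ab N0 cellP; pose A := [set node a b N j | j in [set: nat]].
have cA : countable A by apply: sub_countable (card_image_le _ _) _; exact: countableP.
exists A; split.
- exact: countable_measurable.
- exact: countable_lebesgue_measure0.
- move=> x /= /not_implyP[]; rewrite in_itv /= => xab nP.
  have [j jN /andP[]] := cell_cover N0 xab.
  rewrite le_eqVlt => /predU1P[<- _|jx]; first by exists j.
  rewrite le_eqVlt => /predU1P[-> |xj]; first by exists j.+1.
  by exfalso; apply/nP/(cellP j) => //; rewrite /cell /= in_itv /= jx xj.
Qed.

(** Membership in [Vh] says nothing about values at the nodes, so the induction adds an open cell
    and then a single point. *)
Lemma measurable_fun_Vh (a b : R) (N k : nat) (w : R -> R) : a < b -> (0 < N)%N ->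
  Vh a b N k w -> measurable_fun (`[a, b]%classic : set (measurableTypeR R)) w.
Proof.
move=> ab N0 wV.
suff H j : (j <= N)%N ->
    measurable_fun (`[a, node a b N j]%classic : set (measurableTypeR R)) w.
  by have := H N (leqnn _); rewrite nodeN.
elim: j => [_|j IH jN].
  by rewrite /node mul0r addr0 set_itv1; exact: measurable_fun_set1.
have -> : (`[a, node a b N j.+1] = `[a, node a b N j] `|`
    (cell a b N j `|` [set node a b N j.+1]))%classic.
  rewrite /cell setUitv1 ?bnd_simp ?node_ltS//.
  rewrite -itv_bndbnd_setU// bnd_simp; first exact: node_ge.
  by rewrite ltW// node_ltS.
apply/measurable_funU; [exact: measurable_itv | | split].
- by apply: measurableU; [exact: measurable_itv | exact: measurable_set1].
- exact: IH (ltnW jN).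
apply/measurable_funU; [exact: measurable_itv | exact: measurable_set1 | split].
- have [p [_ wp]] := wV j jN.
  apply: (eq_measurable_fun (horner p)); first by move=> x /set_mem /wp.
  by apply: measurable_funTS; apply: continuous_measurable_fun; exact: continuous_horner.
- exact: measurable_fun_set1.
Qed.

(** One factor for both exponents: $\sqrt{b-a}$ comes from $p=2$ and 1 from $p=\infty$. *)
Lemma Lp_norm_le (a b B : R) (p : \bar R) (f : R -> R) : a < b -> 0 <= B ->
  measurable_fun (`[a, b]%classic : set (measurableTypeR R)) f ->
  (\forall x \ae mu, `[a, b]%classic x -> `|f x| <= B) ->
  p = 2%:E \/ p = +oo%E ->
  (Lp_norm a b p f <= (B * (1 + Num.sqrt (b - a)))%:E)%E.
Proof.
move=> ab B0 mf fB; have s0 := sqrtr_ge0 (b - a).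
rewrite /Lp_norm unlock /Lnorm => -[] ->.
- have -> : (\int[mu]_x (`|(EFin \o (f \_ `[a, b])) x| `^ 2) =
      \int[mu]_(x in `[a, b]) (`|f x| ^+ 2)%:E)%E.
    rewrite [RHS]integral_mkcond; apply: eq_integral => x _ /=.
    rewrite !patchE; case: ifPn => _; last by rewrite normr0 powR0 ?pnatr_eq0.
    by rewrite -powR_mulrn.
  have le1 : (\int[mu]_(x in `[a, b]) (`|f x| ^+ 2)%:E <= (B ^+ 2 * (b - a))%:E)%E.
    have -> : ((B ^+ 2 * (b - a))%:E = (B ^+ 2)%:E * mu `[a, b]%classic)%E.
      by rewrite lebesgue_measure_itv /= lte_fin ab -EFinB -EFinM.
    have -> : (\int[mu]_(x in `[a, b]) (`|f x| ^+ 2)%:E =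
        \int[mu]_(x in `[a, b]) `|(`|f x| ^+ 2)%:E|)%E.
      by apply: eq_integral => x _; rewrite gee0_abs// lee_fin exprn_ge0.
    apply: integral_le_bound.
    + exact: measurable_itv.
    + apply/measurable_EFinP; apply: measurable_funX.
      exact: measurableT_comp.
    + by rewrite lee_fin exprn_ge0.
    + apply: ae_sub fB => x h /h fxB.
      by rewrite gee0_abs ?lee_fin ?exprn_ge0// lerXn2r.
  apply: (@le_trans _ _ ((B ^+ 2 * (b - a))%:E `^ 2^-1)%E).
    have ge0 : (0 <= \int[mu]_(x in `[a, b]) (`|f x| ^+ 2)%:E)%E.
      by apply: integral_ge0 => x _; rewrite lee_fin exprn_ge0.
    apply: gt0_ler_poweR => //; rewrite in_itv /= ?ge0 ?leey//.
    by rewrite lee_fin mulr_ge0 ?exprn_ge0// subr_ge0 ltW.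
  rewrite poweR_EFin powR12_sqrt; last by rewrite mulr_ge0 ?exprn_ge0// subr_ge0 ltW.
  rewrite lee_fin sqrtrM ?exprn_ge0// sqrtr_sqr ger0_norm// ler_wpM2l//.
  by rewrite lerDr.
- case: ifPn => _; last by rewrite lee_fin mulr_ge0// addr_ge0.
  apply/ess_supP; apply: ae_sub fB => x h /=.
  rewrite lee_fin patchE; case: ifPn => [/set_mem/h fxB|_].
    by rewrite (le_trans fxB)// ler_peMr// lerDl.
  by rewrite normr0 mulr_ge0// addr_ge0.
Qed.

(** [xget] returns a genuine weak derivative since one exists; being essentially bounded on the
    whole line, it has a finite seminorm, which is itself the almost-everywhere bound on $[a,b]$. *)
Lemma W_infty_seminorm_fin (a b : R) m (u : R -> R) : a < b -> W_infty m u ->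
  exists2 M : R, 0 <= M & W_infty_seminorm a b m u = M%:E /\
    exists2 g, weak_derivn_Linfty m u g &
      \forall x \ae mu, `[a, b]%classic x -> `|g x| <= M.
Proof.
move=> ab uW; rewrite /W_infty_seminorm.
have : weak_derivn_Linfty m u (xget (cst 0) [set g | weak_derivn_Linfty m u g]).
  by case: uW => g0 ug0; apply: (xgetPex (cst 0)); exists g0.
move: (xget _ _) => g ug.
have [_ [M M0 gM]] := Linfty_ae_bounded (weak_derivn_Linfty_last ug).
rewrite /Lp_norm unlock /Lnorm lebesgue_measure_setT_gt0.
set S := ess_sup _ _.
have SM : (S <= M%:E)%E.
  apply/ess_supP; apply: ae_sub gM => x h /=; rewrite lee_fin patchE.
  by case: ifP => // _; rewrite normr0.
have S0 : (0 <= S)%E.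
  apply: ess_sup_gee; first exact: lebesgue_measure_setT_gt0.
  by apply: ae_all => x /=; rewrite lee_fin.
have Sfin : S \is a fin_num by rewrite ge0_fin_numE// (le_lt_trans SM)// ltry.
exists (fine S); first exact: fine_ge0.
split; first by rewrite fineK.
exists g => //; apply: ae_sub (ess_sup_ge mu (abse \o (EFin \o (g \_ `[a, b])))).
move=> x; rewrite -/S -[S]fineK//= lee_fin => + xab.
by rewrite patchE mem_set.
Qed.

End LpBound.

Theorem lemma3p6 (R : realType) (a b : R) (hab : a < b) (k : nat)
    (hk : (1 <= k)%N) (delta cl cu : R) (hcl : 0 < cl) (hcu : 0 < cu) :
  exists C : R, 0 < C /\
  forall (N : nat) (alpha1 beta1 beta2 : R) (u w : R -> R) (p : \bar R),
    let h := mesh_size a b N in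
    let lam := lambda1 k h alpha1 beta1 beta2 in
    (0 < N)%N ->
    alpha1 ^+ 2 + beta1 * beta2 != 1 / 4 ->
    `|Gamma k h alpha1 beta1 beta2| < `|Lambda k h alpha1 beta1 beta2| ->
    lam ^+ N != 1 ->
    cl * h `^ delta <= cmod (1 - lam ^+ N) <= cu * h `^ delta ->
    periodic u (b - a) ->
    continuous u ->
    W_infty k.+1 u ->
    is_Pstar a b N k alpha1 beta1 beta2 u w ->
    p = 2%:E \/ p = +oo%E ->
    (Lp_norm a b p (fun x => w x - u x)%R
     <= (C * h ^+ k.+1)%:E * W_infty_seminorm a b k.+1 u *
        (1 + h `^ (- (delta + 1)) *
             mnorm_oo (Q1 k h alpha1 beta1 beta2) *
             (vnorm_oo (V1 k h alpha1 beta1 beta2)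
              + h^-1 * vnorm_oo (V2 k h)))%:E)%E.
Proof.
have [K K0 HK] := Pstar_cell_error R hk.
have ba0 : 0 < b - a by rewrite subr_gt0.
have s0 : 0 <= Num.sqrt (b - a) := sqrtr_ge0 _.
(* The summand 1 gives [Cl >= 1], so [Cl] can be factored out of the whole bracket $1+\dots$ later
   on. *)
pose Cl := 1 + (b - a) / cl.
have Cl1 : 1 <= Cl by rewrite lerDl divr_ge0// ltW.
exists (K * Cl * (1 + Num.sqrt (b - a))); split.
  by rewrite !mulr_gt0 ?(lt_le_trans ltr01 Cl1)// ltr_wpDr.
move=> N al be1 be2 u w p h lam N0 _ GL lamN /andP[lamcl _] per cu0 uW uP hp.
have h0 : 0 < h := mesh_size_gt0 hab N0.
have [M M0 [-> [g ug gM]]] := W_infty_seminorm_fin hab uW.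
have [V [V1' [uV cV dV VT]]] := weak_taylor M0 ug gM.
(* Continuity singles out the regular representative: [u] itself now has the derivative and Taylor
   bounds, not just almost everywhere. *)
have uE : u = V := ae_eq_continuous cu0 cV uV; subst V.
have taylor c : a <= c -> exists2 T : {poly R}, (size T <= k.+1)%N &
    forall x, c <= x <= b -> `|u x - T.[x]| <= M * (x - c) ^+ k.+1 /\
      `|V1' x - T^`().[x]| <= M * (x - c) ^+ k.
  move=> /VT[T sT TP]; exists T => // x /TP[T1 T2]; split=> //; exact: T2.
have cell_err := HK a b N al be1 be2 M u V1' w hab N0 GL lamN per cu0 (dV hk) M0 taylor uP.
pose S := mnorm_oo (Q1 k h al be1 be2) *
  (vnorm_oo (V1 k h al be1 be2) + h^-1 * vnorm_oo (V2 k h)).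
have S0 : 0 <= S.
  by rewrite mulr_ge0 ?mnorm_oo_ge0// addr_ge0 ?mulr_ge0 ?vnorm_oo_ge0// invr_ge0 ltW.
pose Bd := K * M * h ^+ k.+1 * (Cl * (1 + h `^ (- (delta + 1)) * S)).
have X0 : 0 <= h `^ (- (delta + 1)) * S by rewrite mulr_ge0// powR_ge0.
have KMh0 : 0 <= K * M * h ^+ k.+1 by rewrite !mulr_ge0 ?exprn_ge0// ltW.
have Bd0 : 0 <= Bd.
  apply: mulr_ge0 => //; apply: mulr_ge0; first exact: le_trans ler01 Cl1.
  exact: addr_ge0.
(* Here $Nh=b-a$ meets the lower bound $c_l h^{\delta}$ on $|1-\lambda_1^N|$. *)
have Nlam : N%:R / cmod (1 - lam ^+ N) <= (b - a) / cl * h `^ (- (delta + 1)).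
  have hd : 0 < cl * h `^ delta by rewrite mulr_gt0// powR_gt0.
  rewrite ler_pdivrMr ?(lt_le_trans hd)//.
  have -> : N%:R = (b - a) / cl * h `^ (- (delta + 1)) * (cl * h `^ delta).
    rewrite powRN powRD; last by apply/implyP => _; rewrite gt_eqF.
    rewrite powRr1 ?ltW//.
    rewrite -(mesh_size_mul a b N0) -/h; field.
    by rewrite !gt_eqF// powR_gt0.
  apply: ler_wpM2l => //; apply: mulr_ge0; last exact: powR_ge0.
  by rewrite divr_ge0// ltW.
have err j x : (j < N)%N -> cell a b N j x -> `|w x - u x| <= Bd.
  move=> jN xj; apply: (le_trans (cell_err j x jN xj)).
  rewrite /Bd ler_wpM2l// -mulrA -/S.
  apply: (@le_trans _ _ (1 + (b - a) / cl * h `^ (- (delta + 1)) * S)).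
    by rewrite lerD2l ler_wpM2r.
  rewrite -mulrA /Cl; move: X0 (Cl1); rewrite /Cl; move: (_ * S) (_ / cl) => X Y *; nra.
have wV : Vh a b N k w by case: uP.
apply: (@le_trans _ _ (Bd * (1 + Num.sqrt (b - a)))%:E).
  apply: (@Lp_norm_le R a b Bd) => //.
    apply: measurable_funB; first exact: measurable_fun_Vh wV.
    by apply: measurable_funTS; exact: continuous_measurable_fun.
  exact: ae_itvcc_cells err.
rewrite -!EFinM lee_fin /Bd -[_ * mnorm_oo _ * _]mulrA -/S.
rewrite le_eqVlt; apply/orP; left; apply/eqP; ring.
Qed.
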